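(* Assume $0<\lambda_1<1<\lambda_2$ are such that $\lambda_1\lambda_2<1$ and $\log_2\lambda_2>1+\log_{1/\lambda_1}\lambda_2$. Then there exists a smooth ($C^\infty$), bounded function $\phi:\mathbb{R}\to\mathbb{R}$ such that $h(\epsilon):=\int_{\mathbb{R}}\phi\,d\mu_{\lambda_1+\epsilon,\lambda_2}$ (defined for $|\epsilon|$ small) is not differentiable at $\epsilon=0$.
   Context: Fix $d_1,d_2\in\mathbb{R}$ such that the maps $x\mapsto\lambda_1x+d_1$ and $x\mapsto\lambda_2x+d_2$ do not have the same fixed point, i.e. $\frac{d_1}{1-\lambda_1}\ne\frac{d_2}{1-\lambda_2}$. For $0<a<1<b$ with $ab<1$, $\mu_{a,b}$ denotes the unique stationary measure of the iterated function system $x\mapsto ax+d_1$, $x\mapsto bx+d_2$ with probabilities $(\frac12,\frac12)$, i.e. the unique Borel probability measure $\mu$ on $\mathbb{R}$ equal to $\frac12$ of its push-forward by the first map plus $\frac12$ of its push-forward by the second map. *)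

(* Defs.v *)
From mathcomp Require Import all_boot all_order all_algebra.
From mathcomp Require Import all_classical all_reals all_analysis.
Set Implicit Arguments.
Unset Strict Implicit.
Unset Printing Implicit Defensive.
Import Order.TTheory GRing.Theory Num.Theory.
Import numFieldNormedType.Exports.
Local Open Scope classical_set_scope.
Local Open Scope ring_scope.

Definition log_base {R : realType} (b x : R) : R := ln x / ln b.

Definition affine {R : realType} (a d : R) : measurableTypeR R -> measurableTypeR R :=
  fun x => a * x + d.

Definition stationary {R : realType} (a d1 b d2 : R)
    (mu : probability (measurableTypeR R) R) : Prop :=
  forall A : set (measurableTypeR R), measurable A ->
    mu A = ((2^-1)%:E * pushforward mu (affine a d1) A
            + (2^-1)%:E * pushforward mu (affine b d2) A)%E.

(* For 0 < a < 1 < b with a * b < 1 there is exactly one stationary probability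
   measure, and [get] selects it; outside this range the value is irrelevant. *)
Definition stationary_measure {R : realType} (d1 d2 a b : R)
    : probability (measurableTypeR R) R :=
  get [set mu | stationary a d1 b d2 mu].

Definition smooth {R : realType} (f : R -> R) : Prop :=
  forall (n : nat) (x : R), derivable (derive1n n f) x 1.

(* Main.v *)
(** Write [a = lambda1], [b = lambda2].  The logarithmic condition forces [a < 1/4].  Fix
    [a < th < 1/4] with [th * b < 1].  Since [k] successive contractions have probability
    [2 ^- k] and the family is uniformly tight, [mu_(a + eps, b)] gives mass at least [c 2 ^- k]
    to a ball of radius [Q th ^ k] round the fixed point of the contraction, hence also round its
    images [y eps] under a fixed word of maps.  These points can be taken as far away as one
    likes, and they move at non-zero speed with [eps].  The balls round
    [y eps_1, ..., y eps_N], for parameters of step about [th ^ k] and [N] about [2 ^ k], are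
    disjoint, so that one of them has small mass for [eps = 0]; a bump function on it has a
    difference quotient of order at least [(4 th) ^- k], which is unbounded.  A gliding hump
    argument adds such bumps, placed further and further away, into one smooth function with
    values in [[0, 1]]; its derivatives need not be bounded. *)
From HB Require Import structures.
Require Import Defs.
From mathcomp Require Import all_boot all_order all_algebra.
From mathcomp Require Import all_classical all_reals all_analysis.
From mathcomp Require Import ring lra measurable_realfun.
Import Order.TTheory GRing.Theory Num.Theory.
Import numFieldNormedType.Exports.
Local Open Scope classical_set_scope.
Local Open Scope ring_scope.

Set Implicit Arguments.
Unset Strict Implicit.

(** * Smooth functions *)

Section smooth_functions.
Context {R : realType}.
Implicit Types f g : R -> R.

Lemma smooth_derivable f x : smooth f -> derivable f x 1.
Proof. by move=> /(_ 0%N x). Qed.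

Lemma smooth_continuous f : smooth f -> continuous f.
Proof.
by move=> sf x; apply: differentiable_continuous; apply/derivable1_diffP;
  exact: smooth_derivable.
Qed.

Lemma near_eq_derive1n f g (x : R) n : {near x, f =1 g} ->
  {near x, derive1n n f =1 derive1n n g}.
Proof.
move=> fg; elim: n => [|n ih]; first exact: fg.
near=> y; rewrite !derive1nS !derive1E; apply: near_eq_derive.
by near: y; exact: near_join ih.
Unshelve. all: end_near. Qed.

(** Serves for the limit of the gliding hump, which near each point agrees with one of the
    approximating functions. *)
Lemma smooth_local f : (forall x : R, exists2 g, smooth g & {near x, g =1 f}) ->
  smooth f.
Proof.
move=> H n x; have [g sg gf] := H x.
exact: near_eq_derivable (near_eq_derive1n _ gf) (sg n x).
Qed.

Lemma smooth_derive1P f : smooth f <-> (forall x, derivable f x 1) /\ smooth (derive1 f).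
Proof.
split=> [sf|[df sf]].
  split=> [x|n x]; first exact: smooth_derivable.
  by move: (sf n.+1 x); rewrite /derive1n iterSr.
by case=> [//|n] x; rewrite /derive1n iterSr; exact: sf.
Qed.

(** No formula for higher derivatives is ever computed: smoothness is obtained by naming a class of
    functions that differentiation preserves. *)
Lemma smooth_coind (P : (R -> R) -> Prop) :
  (forall f, P f -> (forall x, derivable f x 1) /\ P (derive1 f)) ->
  forall f, P f -> smooth f.
Proof.
move=> H f Pf n; elim: n f Pf => [|n ih] f /H[df Pf'] x; first exact: df.
by rewrite /derive1n iterSr; exact: ih.
Qed.

Lemma derivable_affine f (a b x : R) : derivable f (a * x + b) 1 ->
  is_derive x (1 : R) (fun y => f (a * y + b)) (a * (derive1 f) (a * x + b)).
Proof.
move=> df; rewrite mulrC.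
apply: (@is_derive1_comp R f (fun y => a * y + b)).
  by rewrite derive1E; exact: derivableP.
by apply: is_derive_eq; rewrite addr0 /GRing.scale/= mulr1.
Qed.

Lemma smooth_affine f (a b : R) : smooth f -> smooth (fun x => f (a * x + b)).
Proof.
move=> sf.
(* The chain rule brings out a factor [a], so the class has to allow a constant factor [c]. *)
apply: (@smooth_coind (fun h => exists c g, smooth g /\
   h = (fun x => c * g (a * x + b)))); last first.
  by exists 1, f; split => //; apply/funext => x; rewrite mul1r.
move=> _ [c [g [sg ->]]].
have D x : is_derive x (1 : R) (fun y => c * g (a * y + b))
    (c * a * (derive1 g) (a * x + b)).
  rewrite -mulrA; apply: is_deriveZ; apply: derivable_affine.
  exact: smooth_derivable.
split; first by move=> x; exact: ex_derive.
exists (c * a), (derive1 g); split; first by case/smooth_derive1P : sg.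
by apply/funext => x; rewrite derive1E derive_val.
Qed.

Lemma smooth_cst (c : R) : smooth (fun=> c).
Proof.
apply: (@smooth_coind (fun h => exists c, h = (fun=> c))); last by exists c.
move=> _ [d ->]; split; first by move=> x; exact: ex_derive.
by exists 0; apply/funext => x; rewrite derive1E derive_val.
Qed.

Lemma smoothD f g : smooth f -> smooth g -> smooth (fun x => f x + g x).
Proof.
move=> sf sg.
apply: (@smooth_coind (fun h => exists f g, [/\ smooth f, smooth g &
   h = (fun x => f x + g x)])); last by exists f, g.
move=> _ [{sf}f [{sg}g [/smooth_derive1P[df sf] /smooth_derive1P[dg sg] ->]]].
split; first by move=> x; exact: derivableD.
exists (derive1 f), (derive1 g); split => //.
by apply/funext => x; rewrite !derive1E deriveD.
Qed.

(** The Leibniz rule turns one product into a sum of two, so products alone are not preserved by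
    differentiation; their finite sums are. *)
Inductive sum_of_products : (R -> R) -> Prop :=
| sum_of_products1 f g : smooth f -> smooth g ->
    sum_of_products (fun x => f x * g x)
| sum_of_productsD f g : sum_of_products f -> sum_of_products g ->
    sum_of_products (fun x => f x + g x).

Lemma smoothM f g : smooth f -> smooth g -> smooth (fun x => f x * g x).
Proof.
move=> sf sg; apply: (@smooth_coind sum_of_products); last exact: sum_of_products1.
move=> h {sf sg f g}; elim=> {h}[f g sf sg|f g _ [df Pf] _ [dg Pg]].
- have /smooth_derive1P[df sf'] := sf; have /smooth_derive1P[dg sg'] := sg.
  split; first by move=> x; exact: derivableM.
  rewrite (_ : derive1 _ = (fun x => f x * (derive1 g) x + g x * (derive1 f) x)).
    by apply: sum_of_productsD; exact: sum_of_products1.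
  by apply/funext => x; rewrite !derive1E deriveM.
- split; first by move=> x; exact: derivableD.
  rewrite (_ : derive1 _ = (fun x => (derive1 f) x + (derive1 g) x)).
    exact: sum_of_productsD.
  by apply/funext => x; rewrite !derive1E deriveD.
Qed.

End smooth_functions.

(** * Smooth bump functions *)

Section smooth_bump.
Context {R : realType}.
Implicit Types p : {poly R}.

(** The function exp(-1/x), extended by 0 to x <= 0, and all its derivatives have this shape;
    [p = 1] gives the function itself. *)
Definition flat p (x : R) : R := if 0 < x then p.[x^-1] * expR (- x^-1) else 0.

Lemma poly_le_pow p : exists C : R, exists n : nat,
  0 <= C /\ forall y : R, 1 <= y -> `|p.[y]| <= C * y ^+ n.
Proof.
elim/poly_ind: p => [|p c [C [n [C0 H]]]].
  by exists 0, 0%N; split => // y _; rewrite horner0 normr0 mul0r.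
exists (C + `|c|), n.+1; split; first by rewrite addr_ge0.
move=> y y1; rewrite hornerMXaddC (le_trans (ler_normD _ _))// mulrDl lerD//.
  rewrite normrM (ger0_norm (le_trans ler01 y1)) exprSr mulrA.
  by rewrite ler_wpM2r// ?H// (le_trans ler01).
by rewrite ler_peMr// exprn_ege1.
Qed.

(** With y = 1/x, exp(y) >= y^(n+2) / (n+2)! beats the growth y^n of [p] by two powers of y. This
    surplus is the factor x^2 that makes the derivative at 0 vanish. *)
Lemma flat_le_sqr p : exists C : R, forall x, 0 < x <= 1 -> `|flat p x| <= C * x ^+ 2.
Proof.
have [C [n [C0 H]]] := poly_le_pow p.
exists (C * (n.+2)`!%:R) => x /andP[x0 x1].
rewrite /flat x0 normrM (gtr0_norm (expR_gt0 _)).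
have y1 : 1 <= x^-1 by rewrite invf_ge1.
have y0 : 0 < x^-1 by rewrite invr_gt0.
have E : expR (- x^-1) <= (n.+2)`!%:R * x ^+ n.+2.
  have F0 : 0 < (n.+2)`!%:R :> R by rewrite ltr0n fact_gt0.
  have : x^-1 ^+ n.+2 / (n.+2)`!%:R <= expR x^-1.
    by apply: le_trans (expR_ge1Dxn n.+1 (ltW y0)); rewrite lerDr.
  rewrite expRN ler_pdivrMr// exprVn => E.
  rewrite -[leLHS]mul1r ler_pdivrMr ?expR_gt0//.
  rewrite mulrAC mulrC -ler_pdivrMl ?exprn_gt0// mulr1.
  by rewrite mulrC.
apply: (le_trans (ler_pM _ _ (H _ y1) E)); rewrite ?expR_ge0//.
rewrite mulrACA -!mulrA ler_wpM2l// ler_wpM2l//.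
by rewrite -addn2 exprD mulrA exprVn mulVf ?mul1r// expf_neq0// gt_eqF.
Qed.

Lemma is_derive0_quadratic (f : R -> R) (C : R) : f 0 = 0 ->
  (forall x, `|x| <= 1 -> `|f x| <= C * x ^+ 2) -> is_derive (0 : R) (1 : R) f 0.
Proof.
move=> f0 H.
have L : h^-1 *: ((f \o shift 0) (h *: 1) - f 0) @[h --> (0 : R)^'] --> (0 : R).
  apply/cvgr0Pnorm_le => e e0; near=> h.
  have h0 : h != 0 by near: h; exact: nbhs_dnbhs_neq.
  have h1 : `|h| <= 1.
    by near: h; apply: dnbhs0_le.
  have he : `|h| <= e / (`|C| + 1) by near: h; apply: dnbhs0_le; rewrite divr_gt0// ltr_wpDl.
  rewrite /= f0 subr0 addr0 /GRing.scale/= mulr1 normrM normfV.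
  rewrite ler_pdivrMl ?normr_gt0//.
  apply: (le_trans (H _ h1)); rewrite -real_normK ?num_real// expr2 mulrCA.
  rewrite ler_wpM2l//.
  have : `|h| * (`|C| + 1) <= e by rewrite -ler_pdivlMr// ltr_wpDl.
  have := ler_norm C; have := normr_ge0 h; nra.
apply: DeriveDef; first by apply: cvgP; exact: L.
exact: cvg_lim L.
Unshelve. all: end_near. Qed.

(** For y = 1/x one has d/dx = - y^2 d/dy, and d/dy (p(y) exp(-y)) = (p' - p)(y) exp(-y). At 0 the
    quadratic bound applies on the right, and the function is 0 on the left. *)
Lemma is_derive_flat p (x : R) :
  is_derive x (1 : R) (flat p) (flat ('X^2 * (p - p^`())) x).
Proof.
have [x0|x0|->] := ltgtP x 0.
- rewrite [flat _ x]/flat ltNge (ltW x0)/=.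
  have N : {near x, (fun=> 0) =1 flat p}.
    near=> y; rewrite /flat ifF//; apply/negbTE; rewrite -leNgt.
    apply: ltW; near: y; exact: lt_nbhsl.
  by apply: near_eq_is_derive N _.
- rewrite [flat _ x]/flat x0.
  have N : {near x, (fun y => p.[y^-1] * expR (- y^-1)) =1 flat p}.
    by near=> y; rewrite /flat ifT//; near: y; exact: lt_nbhsr.
  apply: near_eq_is_derive N _.
  have xN0 : x != 0 by rewrite gt_eqF.
  have DV : is_derive x (1 : R) (fun y : R => y^-1) (- x ^- 2).
    by apply: is_derive_eq; first exact: is_deriveV; rewrite /GRing.scale/= mulr1.
  have DP : is_derive x (1 : R) (fun y : R => p.[y^-1]) (p^`().[x^-1] * - x ^- 2).
    exact: (is_derive1_comp (is_derive_poly p x^-1) DV).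
  have DE : is_derive x (1 : R) (fun y : R => expR (- y^-1)) (expR (- x^-1) * x ^- 2).
    apply: (is_derive1_comp (f := expR) (g := fun y : R => - y^-1)).
    by apply: is_derive_eq; rewrite opprK.
  apply: is_derive_eq; rewrite /GRing.scale/= !hornerE/=.
  by rewrite -exprVn; ring.
- have [C H] := flat_le_sqr p.
  rewrite {2}/flat ltxx.
  apply: (@is_derive0_quadratic _ `|C|); first by rewrite /flat ltxx.
  move=> y y1; have [y0|y0] := ltP 0 y.
    have {}y1 : y <= 1 by rewrite (le_trans (ler_norm _)).
    rewrite (le_trans (H _ _)) ?y0//; apply: ler_wpM2r; rewrite ?sqr_ge0//.
    exact: ler_norm.
  by rewrite /flat ltNge y0/= normr0 mulr_ge0// sqr_ge0.
Unshelve. all: end_near. Qed.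

Lemma smooth_flat p : smooth (flat p).
Proof.
apply: (@smooth_coind _ (fun f => exists q, f = flat q)); last by exists p.
move=> _ [q ->]; split; first by move=> x; have D := is_derive_flat q x; exact: ex_derive.
exists ('X^2 * (q - q^`())); apply/funext => x.
by rewrite derive1E; have D := is_derive_flat q x; exact: derive_val.
Qed.

Let e := flat 1.

Let e_ge0 x : 0 <= e x.
Proof.
by rewrite /e /flat; case: ifP => // _; rewrite hornerC mul1r expR_ge0.
Qed.

Let e_le1 x : e x <= 1.
Proof.
rewrite /e /flat; case: ifP => // x0; rewrite hornerC mul1r.
by rewrite -expR0 ler_expR oppr_le0 invr_ge0 ltW.
Qed.

(** The bump is a product of two copies of exp(-1/x), one rising from z - r and one falling towards
    z + r. On the ball of half the radius both arguments are at least 1/2, whence the lower bound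
    exp(-2)^2, independent of centre and radius. *)
Lemma smooth_bump : exists2 m : R, 0 < m & forall z r : R, 0 < r ->
  exists f : R -> R, [/\ smooth f, forall x, 0 <= f x <= 1,
    forall x, r <= `|x - z| -> f x = 0 &
    forall x, `|x - z| <= r / 2 -> m <= f x].
Proof.
have half x : 1 / 2 <= x -> expR (- 2) <= e x.
  move=> x2; have x0 : 0 < x by lra.
  rewrite /e /flat x0 hornerC mul1r ler_expR lerN2.
  by rewrite -[leRHS]invrK lef_pV2 ?posrE//; lra.
exists (expR (- 2) * expR (- 2)); first by rewrite mulr_gt0 ?expR_gt0.
move=> z r r0; pose u (x : R) := r^-1 * x + (1 - z / r).
pose v (x : R) := - r^-1 * x + (1 + z / r).
have uE x : u x = 1 + (x - z) / r by rewrite /u; ring.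
have vE x : v x = 1 - (x - z) / r by rewrite /v; ring.
exists (fun x => e (u x) * e (v x)); split.
- by apply: smoothM; apply: smooth_affine; exact: smooth_flat.
- by move=> x; rewrite mulr_ge0//= mulr_ile1.
- move=> x; rewrite uE vE ler_normr -opprB => /orP[|] H.
    rewrite [X in _ * X]/e /flat ifF ?mulr0//; apply/negbTE.
    by rewrite -leNgt subr_le0 ler_pdivlMr// mul1r.
  rewrite [X in X * _]/e /flat ifF ?mul0r//; apply/negbTE.
  rewrite -leNgt -lerBrDl sub0r lerNr -mulNr ler_pdivlMr// mul1r opprB.
  by move: H; rewrite opprB.
- move=> x; rewrite ler_norml => /andP[H1 H2]; apply: ler_pM.
  + exact: expR_ge0.
  + exact: expR_ge0.
  + apply: half; rewrite uE.
    have : - (1 / 2) <= (x - z) / r by rewrite ler_pdivlMr//; lra.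
    lra.
  + apply: half; rewrite vE.
    have : (x - z) / r <= 1 / 2 by rewrite ler_pdivrMr//; lra.
    lra.
Qed.

End smooth_bump.

(** * Existence of stationary measures *)

Section affine_measure.
Context {R : realType}.
Implicit Types a b d e : R.

Lemma affine_continuous a d : continuous (fun x : R => a * x + d).
Proof.
by move=> x; apply: cvgD; [apply: cvgM; [exact: cvg_cst|exact: cvg_id]|exact: cvg_cst].
Qed.

Lemma measurable_affine a d : measurable_fun [set: measurableTypeR R] (affine a d).
Proof.
have : measurable_fun setT (fun x : R => a * x + d).
  apply: measurable_realfun.continuous_measurable_fun; exact: affine_continuous.
exact.
Qed.

End affine_measure.

Definition affine_image (R : realType) (a d : R)
    (mu : {measure set (measurableTypeR R) -> \bar R}) :
  {measure set (measurableTypeR R) -> \bar R}.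
Proof.
by refine (pushforward mu (affine a d)); exact: measurable_affine.
Defined.

(** The right-hand side of the stationarity equation as a measure, so that uniqueness of measures
    and additivity of the integral in the measure apply to it. *)
Definition ifs_measure (R : realType) (a d1 b d2 : R)
    (mu : {measure set (measurableTypeR R) -> \bar R}) :
    {measure set (measurableTypeR R) -> \bar R} :=
  measure_add (mscale (2^-1)%:nng (affine_image a d1 mu))
              (mscale (2^-1)%:nng (affine_image b d2 mu)).

Lemma ifs_measureE (R : realType) (a d1 b d2 : R)
    (mu : {measure set (measurableTypeR R) -> \bar R}) A :
  ifs_measure a d1 b d2 mu A = ((2^-1)%:E * pushforward mu (affine a d1) A
            + (2^-1)%:E * pushforward mu (affine b d2) A)%E.
Proof. exact: measure_addE. Qed.

Lemma stationary_setE (R : realType) (a d1 b d2 : R)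
    (mu : probability (measurableTypeR R) R) A : stationary a d1 b d2 mu ->
  measurable A -> mu A = ifs_measure a d1 b d2 mu A.
Proof. by move=> st mA; rewrite ifs_measureE st. Qed.

(* In the variable [u = ln x] the two maps act for large [x] as the translations by [- M'] and
   [L'] with [L' < M'], and [1 / u] is strictly superharmonic for such a walk. *)
Lemma superharmonic_tail (R : realType) (a b d1 d2 : R) :
  0 < a < 1 -> 1 < b -> a * b < 1 ->
  exists S : R -> R, [/\ continuous S, {homo S : x y / x <= y >-> y <= x},
    forall x, 0 <= S x <= 1,
    S x @[x --> +oo] --> (0 : R) &
    (forall x, x <= 0 -> S x = 1) /\
    forall x, S ((x - d1) / a) + S ((x - d2) / b) <= 2 * S x].
Proof.
move=> /andP[a0 a1] b1 ab.
have b0 : 0 < b by lra.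
set M := - ln a; set L := ln b.
have L0 : 0 < L by rewrite /L ln_gt0.
have ML : L < M.
  have : ln (a * b) < 0 by rewrite ln_lt0// ab mulr_gt0.
  by rewrite lnM ?posrE// /M /L; lra.
(* The gap M - L is split in three: one [dl] weakens each translation to absorb [d1] and [d2], and
   the third is the remaining drift [M' - L']. *)
pose dl := (M - L) / 3; pose M' := M - dl; pose L' := L + dl.
have dl0 : 0 < dl by rewrite /dl; lra.
have M'0 : 0 < M' by rewrite /M' /dl; lra.
have L'0 : 0 < L' by rewrite /L' addr_gt0.
have ML' : M' - L' = dl by rewrite /M' /L' /dl; field.
pose k := 1 - expR (- dl).
have k0 : 0 < k by rewrite subr_gt0 expR_lt1 oppr_lt0.
pose D := `|d1| + `|d2|.
have D0 : 0 <= D by rewrite addr_ge0.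
have D1 : d1 <= D by rewrite /D; have := ler_norm d1; have := normr_ge0 d2; lra.
have D2 : d2 <= D by rewrite /D; have := ler_norm d2; have := normr_ge0 d1; lra.
(* Beyond the threshold [u0], the term [L'] keeps [u - L'] positive, [2 * (M' * L') / dl] lets the
   drift dominate the second-order error of 1/u, and [D / k] makes a shift by at most [D] cost at
   most a factor exp(-dl). *)
pose u0 := 1 + L' + 2 * (M' * L') / dl + D / k.
have A0 : 0 <= 2 * (M' * L') / dl by rewrite ltW// divr_gt0// mulr_gt0// mulr_gt0.
have B0 : 0 <= D / k by rewrite divr_ge0// ltW.
have u01 : 1 <= u0 by rewrite /u0; move: A0 B0 L'0; set A := _ / dl; set B := _ / k; lra.
have u0L : L' < u0 by rewrite /u0; move: A0 B0; set A := _ / dl; set B := _ / k; lra.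
have u0A : 2 * (M' * L') / dl <= u0 by rewrite /u0; move: A0 B0; set A := _ / dl; set B := _ / k; lra.
have u0B : D / k <= u0 by rewrite /u0; move: A0 B0; set A := _ / dl; set B := _ / k; lra.
have u00 : 0 < u0 by lra.
(* [ln] takes the value 0 on x <= 0, so [m] is [u0] and [S] is 1 there. *)
pose m x := Num.max u0 (ln x).
have m0 x : 0 < m x by rewrite /m lt_max u00.
have mu0 x : u0 <= m x by rewrite /m le_max lexx.
pose S x := u0 / m x.
have S01 x : 0 <= S x <= 1.
  by rewrite divr_ge0 ?(ltW u00) ?(ltW (m0 x))//= ler_pdivrMr// mul1r.
have Sle w y : 0 < w -> w <= ln y -> S y <= u0 / w.
  by move=> w0 wy; rewrite ler_pM2l// lef_pV2 ?posrE// /m le_max wy orbT.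
have S1 x : x < 1 -> S x = 1.
  move=> x1; rewrite /S /m; have -> : Num.max u0 (ln x) = u0.
    by apply/max_idPl; apply: le_trans (ltW u00); rewrite ln_le0// ltW.
  by rewrite divff// gt_eqF.
exists S; split => //.
- move=> x; have [x0|x0] := ltP 0 x; last first.
    have N : {near x, (fun=> 1) =1 S}.
      by near=> y; rewrite S1//; near: y; apply: lt_nbhsl; rewrite (le_lt_trans x0).
    rewrite /continuous_at S1 ?(le_lt_trans x0)//.
    exact: cvg_trans (near_eq_cvg N) (cvg_cst _).
  apply: cvgM; first exact: cvg_cst.
  apply: cvgV; first by rewrite gt_eqF.
  apply: (@continuous_max R R (fun=> u0) (@ln R)); first exact: cvg_cst.
  exact: continuous_ln.
- move=> x y xy; have [x1|x1] := ltP x 1.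
    by rewrite (S1 _ x1); case/andP: (S01 y).
  rewrite /S ler_pM2l// lef_pV2 ?posrE//.
  rewrite /m ge_max !le_max lexx/= orbC ler_ln ?xy// posrE; lra.
- apply/cvgr0Pnorm_le => e e0; near=> x.
  have /andP[Sx _] := S01 x; rewrite ger0_norm//.
  have : S x <= u0 / (u0 / e).
    apply: Sle; first by rewrite divr_gt0.
    rewrite -[leLHS]expRK; have E : expR (u0 / e) <= x.
      by near: x; apply: nbhs_pinfty_ge; rewrite num_real.
    by rewrite ler_ln// posrE ?expR_gt0// (lt_le_trans (expR_gt0 _) E).
  by rewrite invfM mulrA divff ?gt_eqF// mul1r invrK.
- split=> [x x0|x]; first by rewrite S1// (le_lt_trans x0).
  have [xu|xu] := leP (ln x) u0.
    have -> : S x = 1 by rewrite /S /m (max_idPl xu) divff// gt_eqF.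
    have /andP[_ h1] := S01 ((x - d1) / a).
    have /andP[_ h2] := S01 ((x - d2) / b).
    by rewrite mulr1 (le_trans (lerD h1 h2))//; lra.
  have x0 : 0 < x.
    by rewrite ltNge; apply/negP => /ln0 x0; move: xu; rewrite x0; lra.
  set u := ln x in xu *.
  have up : 0 < u := lt_trans u00 xu.
  have uL : 0 < u - L' by rewrite subr_gt0; exact: lt_trans u0L xu.
  have uM : 0 < u + M' := addr_gt0 up M'0.
  have xE : expR u = x by rewrite lnK.
  have xk : D <= x * k.
    rewrite -ler_pdivrMr// -xE (le_trans u0B)// (le_trans (ltW xu))//.
    by apply: le_trans (expR_ge1Dx u); rewrite lerDr.
  have xd d : d <= D -> x * expR (- dl) <= x - d.
    move=> dD; rewrite lerBrDr addrC -lerBrDr (le_trans dD)// (le_trans xk)//.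
    by rewrite /k mulrBr mulr1.
  have -> : S x = u0 / u by rewrite /S /m (max_idPr _)// ltW.
  have h1 : S ((x - d1) / a) <= u0 / (u + M').
    apply: Sle => //.
    have E : expR (u + M') <= (x - d1) / a.
      rewrite [X in expR X](_ : _ = u + (- dl) + (- ln a)); last by rewrite /M' /M; ring.
      rewrite 2!expRD [expR (- ln a)]expRN xE lnK//.
      by rewrite ler_pM2r ?invr_gt0// xd.
    by rewrite -[leLHS]expRK ler_ln// posrE ?expR_gt0// (lt_le_trans (expR_gt0 _) E).
  have h2 : S ((x - d2) / b) <= u0 / (u - L').
    apply: Sle => //.
    have E : expR (u - L') <= (x - d2) / b.
      rewrite [X in expR X](_ : _ = u + (- dl) + (- L)); last by rewrite /L'; ring.
      rewrite 2!expRD [expR (- L)]expRN xE lnK//.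
      by rewrite ler_pM2r ?invr_gt0// xd.
    by rewrite -[leLHS]expRK ler_ln// posrE ?expR_gt0// (lt_le_trans (expR_gt0 _) E).
  apply: (le_trans (lerD h1 h2)).
  (* 2/u - 1/(u + M') - 1/(u - L') has numerator u (M' - L') - 2 M' L', nonnegative since u > u0. *)
  rewrite -subr_ge0.
  rewrite [X in 0 <= X](_ : _ = u0 * (u * dl - 2 * (M' * L')) / (u * (u + M') * (u - L'))).
    rewrite divr_ge0 ?mulr_ge0//; try exact: ltW.
    rewrite subr_ge0 -ler_pdivrMr//; lra.
  by rewrite -ML'; field; rewrite !gt_eqF.
Unshelve. all: end_near. Qed.

Section stationary_existence.
Context {R : realType}.
Implicit Types (a b d x y : R).

Lemma preimage_affine_itv a d x y : 0 < a ->
  affine a d @^-1` `]x, y]%classic = `](x - d) / a, (y - d) / a]%classic.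
Proof.
move=> a0; apply/seteqP; split => z /=; rewrite !in_itv/= /affine.
  by rewrite ltr_pdivrMr// ler_pdivlMr// ltrBlDr lerBrDr (mulrC z).
by rewrite ltr_pdivrMr// ler_pdivlMr// ltrBlDr lerBrDr (mulrC z).
Qed.

Lemma lebesgue_stieltjes_itv (F : cumulative R R) x y : x <= y ->
  lebesgue_stieltjes_measure F `]x, y]%classic = (F y - F x)%:E.
Proof.
move=> xy; rewrite /lebesgue_stieltjes_measure /measure_extension/=.
by rewrite measurable_mu_extE/= ?wlength_itv_bnd//; exact: is_ocitv.
Qed.

(** The equation for [F] is stationarity tested on half-open intervals, and a Lebesgue-Stieltjes
    measure is determined by its values there. *)
Lemma stationary_of_cdf a d1 b d2 (F : R -> R) : 0 < a -> 0 < b ->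
  nondecreasing F -> right_continuous F ->
  F x @[x --> -oo] --> (0 : R) -> F x @[x --> +oo] --> (1 : R) ->
  (forall x, F x = (F ((x - d1) / a) + F ((x - d2) / b)) / 2) ->
  exists mu : probability (measurableTypeR R) R, stationary a d1 b d2 mu.
Proof.
move=> a0 b0 ndF rcF F0 F1 FE.
pose F' : cumulativeBounded (0 : R) (1 : R) := HB.pack F
  (isCumulative.Build _ _ R F ndF rcF) (isCumulativeBounded.Build R 0 1 F F0 F1).
exists (lebesgue_stieltjes_measure F') => A mA.
rewrite -ifs_measureE.
apply: lebesgue_stieltjes_measure_unique => // _ [[x y] _ <-] /=.
have [xy|yx] := leP x y; last first.
  by rewrite set_itv_ge ?measure0// bnd_simp -leNgt ltW.
have im e d : 0 < e -> pushforward (lebesgue_stieltjes_measure F') (affine e d)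
    `]x, y]%classic = (F ((y - d) / e) - F ((x - d) / e))%:E.
  move=> e0; rewrite /pushforward preimage_affine_itv//.
  by apply: lebesgue_stieltjes_itv; rewrite ler_pM2r ?invr_gt0// lerB.
rewrite ifs_measureE im// im// (lebesgue_stieltjes_itv F' xy).
rewrite -!EFinM -EFinD; congr EFin; rewrite /= (FE x) (FE y); ring.
Qed.

Definition cdf_transfer a d1 b d2 (F : R -> R) x : R :=
  (F ((x - d1) / a) + F ((x - d2) / b)) / 2.

(** Monotone iteration: [G] is a subsolution and [H] a supersolution of the fixed point equation of
    [P], with [G <= H], so the iterates of [H] decrease to a fixed point [F] above [G]. The limit of
    [F] at -oo is forced by [H], the one at +oo by [G]. *)
Lemma stationary_exists a d1 b d2 : 0 < a < 1 -> 1 < b -> a * b < 1 ->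
  exists mu : probability (measurableTypeR R) R, stationary a d1 b d2 mu.
Proof.
move=> a01 b1 ab; have /andP[a0 _] := a01; have b0 : 0 < b by lra.
have [S [cS ndS S01 Sy [S1 Sle]]] := superharmonic_tail d1 d2 a01 b1 ab.
(* The reflection x -> -x conjugates the system to the one with translations [- d1] and [- d2]; this
   supplies the tail at -oo. *)
have [S' [cS' ndS' S'01 S'y [S'1 S'le]]] :=
  superharmonic_tail (- d1) (- d2) a01 b1 ab.
pose G x := 1 - S x; pose H x := S' (- x).
pose P := cdf_transfer a d1 b d2.
have Pmono f g : (forall x, f x <= g x) -> forall x, P f x <= P g x.
  by move=> fg x; rewrite ler_pM2r ?invr_gt0// lerD.
have PG x : G x <= P G x.
  by rewrite /P /cdf_transfer ler_pdivlMr// /G; have := Sle x; lra.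
have PH x : P H x <= H x.
  rewrite /P /cdf_transfer ler_pdivrMr// /H -!mulNr !opprB.
  by have := S'le (- x); rewrite !opprK ![_ + (- x)]addrC -mulrC; lra.
have GH x : G x <= H x.
  have [x0|x0] := leP x 0.
    by rewrite /G S1// subrr /H; case/andP: (S'01 (- x)).
  rewrite /H S'1 ?oppr_le0 ?(ltW x0)// /G.
  by have /andP[] := S01 x; lra.
pose u n := iter n P H.
have Gu n x : G x <= u n x.
  elim: n x => [|n ih] x; first exact: GH.
  by apply: le_trans (PG x) _; exact: Pmono.
have uS n x : u n.+1 x <= u n x.
  by elim: n x => [|n ih] x; [exact: PH|exact: Pmono].
have und x : {homo (fun n => u n x) : n m / (n <= m)%N >-> m <= n}.
  by apply/nonincreasing_seqP => n; exact: uS.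
have ucvg x : cvgn (fun n => u n x).
  by apply: nonincreasing_is_cvgn => //; exists (G x) => _ [n _ <-]; exact: Gu.
pose F x := limn (fun n => u n x).
have Fu n x : F x <= u n x by exact: (nonincreasing_cvgn_ge (und x)).
have u_ge0 n x : 0 <= u n x.
  elim: n x => [|n ih] x; first by case/andP: (S'01 (- x)).
  by rewrite divr_ge0// addr_ge0.
have F_ge0 x : 0 <= F x by apply: limr_ge => //; near=> n; exact: u_ge0.
have GF x : G x <= F x by apply: limr_ge => //; near=> n; exact: Gu.
have und' n : nondecreasing (u n).
  elim: n => [|n ih] x y xy; first by apply: ndS'; rewrite lerN2.
  by rewrite ler_pM2r ?invr_gt0// lerD// ih// ler_pM2r ?invr_gt0// lerB.
have ucont n : continuous (u n).
  elim: n => [|n ih] x.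
    by apply: (continuous_comp (f := fun x => - x) (g := S')); [exact: opp_continuous|exact: cS'].
  apply: cvgM; last exact: cvg_cst.
  have c d e : {for x, continuous (fun y : R => u n ((y - d) / e))}.
    apply: (continuous_comp (f := fun y => (y - d) / e) (g := u n)); last exact: ih.
    by apply: cvgM; [apply: cvgB; [exact: cvg_id|exact: cvg_cst]|exact: cvg_cst].
  by apply: cvgD; exact: c.
apply: (@stationary_of_cdf a d1 b d2 F) => //.
- move=> x y xy; apply: ler_lim => //; near=> n; exact: und'.
(* Right continuity: one continuous iterate that lies below [F x + e] at [x] bounds [F] from above
   near [x], and monotonicity of [F] bounds it from below. *)
- move=> x; apply/cvgrPdist_le => e e0.
  have [n un] : exists n, u n x < F x + e.
    have : \forall n \near \oo, u n x < F x + e.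
      by apply: (cvgr_lt (F x) (ucvg x)); rewrite ltrDl.
    by case=> n _ /(_ n (leqnn n)); exists n.
  near=> y.
  have xy : x <= y by apply: ltW; near: y; exact: nbhs_right_gt.
  have uy : u n y <= F x + e.
    by near: y; apply: (cvgr_le (u n x)) un; apply: cvg_at_right_filter; exact: ucont.
  have FF : F x <= F y by apply: ler_lim => //; near=> m; exact: und'.
  by rewrite ler0_norm ?subr_le0// opprB lerBlDl (le_trans (Fu n y)).
- apply: (squeeze_cvgr (f := fun=> 0) (h := H)) _ (cvg_cst _) _.
    by near=> x; rewrite F_ge0 (Fu 0%N).
  rewrite cvgNy_compNP (_ : H \o -%R = S')//.
  by apply/funext => x; rewrite /H/= opprK.
- apply: (squeeze_cvgr (f := G) (h := fun=> 1)) _ _ (cvg_cst _).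
    by near=> x; rewrite GF/= (le_trans (Fu 0%N x))//; case/andP: (S'01 (- x)).
  by rewrite -[X in _ --> X]subr0; apply: cvgB => //; exact: cvg_cst.
- move=> x; rewrite {1}/F; apply/cvg_lim => //; rewrite -cvg_shiftS.
  by apply: cvgM; [apply: cvgD; exact: ucvg|exact: cvg_cst].
Unshelve. all: end_near. Qed.

End stationary_existence.

(** * Uniform tightness *)

Section bounded_measurable.
Context {R : realType}.
Implicit Types (f g : R -> R) (mu : probability (measurableTypeR R) R).

Definition bounded_measurable f :=
  measurable_fun [set: measurableTypeR R] f /\ exists C, forall x, `|f x| <= C.

Lemma bounded_measurable_integrable mu f : bounded_measurable f ->
  mu.-integrable setT (EFin \o f).
Proof.
move=> [mf [C fC]]; apply: measurable_bounded_integrable => //.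
  by apply: (le_lt_trans (probability_le1 mu measurableT)); rewrite ltry.
by exists C; split; [exact: num_real|move=> M CM x _; exact: le_trans (fC x) (ltW CM)].
Qed.

Lemma bounded_measurable_cst c : bounded_measurable (fun=> c).
Proof. by split; [exact: measurable_cst|exists `|c|]. Qed.

Lemma bounded_measurableD f g : bounded_measurable f -> bounded_measurable g ->
  bounded_measurable (fun x => f x + g x).
Proof.
move=> [mf [C fC]] [mg [D gD]]; split; first exact: measurable_funD.
by exists (C + D) => x; rewrite (le_trans (ler_normD _ _))// lerD.
Qed.

Lemma bounded_measurableZ c f : bounded_measurable f ->
  bounded_measurable (fun x => c * f x).
Proof.
move=> [mf [C fC]]; split; first by apply: measurable_funM => //; exact: measurable_cst.
by exists (`|c| * C) => x; rewrite normrM ler_wpM2l.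
Qed.

Lemma bounded_measurable_affine a d f : bounded_measurable f ->
  bounded_measurable (f \o affine a d).
Proof.
move=> [mf [C fC]]; split; last by exists C => x; exact: fC.
apply: measurableT_comp mf _; apply: measurable_realfun.continuous_measurable_fun.
exact: affine_continuous.
Qed.

Lemma bounded_measurable_indic (a b : R) : bounded_measurable \1_`[a, b].
Proof.
split; first exact: measurable_indic.
by exists 1 => x; rewrite indicE; case: (_ \in _); rewrite /= ?normr1 ?normr0.
Qed.

Lemma Rintegral_indic mu (a b : R) :
  \int[mu]_x (\1_`[a, b] x : R) = fine (mu `[a, b]%classic).
Proof. by rewrite /Rintegral integral_indic// setIT. Qed.

Lemma stationary_Rintegral a d1 b d2 mu f : stationary a d1 b d2 mu ->
  bounded_measurable f -> (forall x, 0 <= f x) ->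
  \int[mu]_x f x = (\int[mu]_x f (affine a d1 x) + \int[mu]_x f (affine b d2 x)) / 2.
Proof.
move=> st bf f0; have [mf _] := bf.
have mEf : measurable_fun [set: measurableTypeR R] (EFin \o f).
  exact/measurable_EFinP.
have f0' : forall x : measurableTypeR R, [set: measurableTypeR R] x -> (0 <= (EFin \o f) x)%E.
  by move=> x _; rewrite lee_fin f0.
have im e d : (\int[affine_image e d mu]_x (f x)%:E =
    (\int[mu]_x f (affine e d x))%:E)%E.
  rewrite /Rintegral fineK.
    apply: (ge0_integral_pushforward (measurable_affine e d) mu) => //.
    by move=> x _; rewrite lee_fin.
  apply: integrable_fin_num => //.
  exact: (bounded_measurable_integrable mu (bounded_measurable_affine e d bf)).
rewrite {1}/Rintegral.
rewrite (eq_measure_integral (ifs_measure a d1 b d2 mu)); last first.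
  by move=> A mA _; exact: stationary_setE.
rewrite /ifs_measure ge0_integral_measure_add//.
rewrite !ge0_integral_mscale// !im -!EFinM -EFinD /=; by field.
Qed.

End bounded_measurable.

Section tightness.
Context {R : realType}.
Implicit Types (mu : probability (measurableTypeR R) R).

Lemma le_fine_probability mu (A B : set (measurableTypeR R)) :
  measurable A -> measurable B -> A `<=` B -> fine (mu A) <= fine (mu B).
Proof.
move=> mA mB AB; apply: fine_le; [exact: fin_num_measure|exact: fin_num_measure|].
by apply: le_measure => //; rewrite inE.
Qed.

Lemma probability_itvT mu (e : R) : 0 < e ->
  exists2 N0 : R, 0 < N0 & forall N, N0 <= N -> 1 - e <= fine (mu `[- N, N]%classic).
Proof.
move=> e0; pose I n : set (measurableTypeR R) := `[- n%:R, n%:R]%classic.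
have cI : (mu \o I) n @[n --> \oo] --> 1%E.
  rewrite -(probability_setT mu) -(bigcup_itvT true false).
  apply: nondecreasing_cvg_mu; rewrite /I//; first exact: bigcup_measurable.
  by move=> *; apply/subsetPset/subset_itv; rewrite bnd_simp ?lerN2 ler_nat.
have /fine_cvg/= cI' : (mu \o I) n @[n --> \oo] --> (1%:E : \bar R) by [].
have : \forall n \near \oo, 1 - e <= fine (mu (I n)).
  by apply: (cvgr_ge _ cI'); rewrite ltrBlDr ltrDl.
case=> n _ /(_ n (leqnn n)) H; exists n.+1%:R => // N nN.
apply: (le_trans H); apply: le_fine_probability => //; try exact: measurable_itv.
have nN' : n%:R <= N by rewrite (le_trans _ nN)// ler_nat.
by apply: subset_itv; rewrite bnd_simp ?lerN2.
Qed.

(* [ln (1 + |x|)] is a Lyapunov function: its drift is negative far away because [th * b < 1] *)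
Lemma log_drift (th b D : R) : 0 < th -> th <= b -> 0 < b -> th * b < 1 -> 0 <= D ->
  exists Q g C : R, [/\ 0 < Q, 0 < g, 0 < C &
  forall a d1 d2 : R, 0 < a -> a <= th -> `|d1| <= D -> `|d2| <= D ->
  (forall x : R, (ln (1 + `|a * x + d1|) + ln (1 + `|b * x + d2|)) / 2
     <= ln (1 + `|x|) + C) /\
  (forall x : R, Q < `|x| ->
     (ln (1 + `|a * x + d1|) + ln (1 + `|b * x + d2|)) / 2 + g
     <= ln (1 + `|x|))].
Proof.
move=> th0 thb b0 thb1 D0.
pose E := 1 + D; have E1 : 1 <= E by rewrite lerDl.
have E0 : 0 <= E := le_trans ler01 E1.
(* [k] is the midpoint of [th * b] and 1, and [eta] is [k - th * b]. [B] collects the lower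
   coefficients of (E + th y)(E + b y); [Q] is chosen so that B <= eta y for y >= Q. *)
pose k := (1 + th * b) / 2.
have k0 : 0 < k by rewrite divr_gt0// addr_gt0// mulr_gt0.
have k1 : k < 1 by rewrite ltr_pdivrMr// mul1r; lra.
pose eta := (1 - th * b) / 2.
have eta0 : 0 < eta by rewrite divr_gt0// subr_gt0.
pose B := E ^+ 2 + E * (th + b).
have B0 : 0 <= B.
  by rewrite addr_ge0 ?sqr_ge0// mulr_ge0// ltW// addr_gt0.
pose Q := 1 + B / eta.
have Q1 : 1 <= Q by rewrite lerDl divr_ge0// ltW.
exists Q, (- ln k / 2), (ln (E + b)); split.
- by rewrite (lt_le_trans ltr01).
- by rewrite divr_gt0// oppr_gt0 ln_lt0// k0.
- by rewrite ln_gt0// ltr_pwDr.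
move=> a d1 d2 a0 ath d1D d2D.
have aff c d (x : R) : 0 < c -> `|d| <= D -> 1 + `|c * x + d| <= E + c * `|x|.
  move=> c0 dD; have := ler_normD (c * x) d.
  by rewrite normrM (gtr0_norm c0) /E; lra.
have l1 x : ln (1 + `|a * x + d1|) <= ln (E + th * `|x|).
  rewrite ler_ln ?posrE; last 2 first.
  - by rewrite ltr_pwDl.
  - by rewrite ltr_pwDl ?(lt_le_trans ltr01)// mulr_ge0// ltW.
  by rewrite (le_trans (aff _ _ _ a0 d1D))// lerD2l ler_wpM2r.
have l2 x : ln (1 + `|b * x + d2|) <= ln (E + b * `|x|).
  rewrite ler_ln ?posrE; last 2 first.
  - by rewrite ltr_pwDl.
  - by rewrite ltr_pwDl ?(lt_le_trans ltr01)// mulr_ge0// ltW.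
  exact: aff.
have p1 (x : R) : 0 < E + th * `|x|.
  by rewrite ltr_pwDl ?(lt_le_trans ltr01)// mulr_ge0// ltW.
have p2 (x : R) : 0 < E + b * `|x|.
  by rewrite ltr_pwDl ?(lt_le_trans ltr01)// mulr_ge0// ltW.
have px (x : R) : 0 < 1 + `|x| by rewrite ltr_pwDl.
have Eb : 0 < E + b by rewrite addr_gt0// (lt_le_trans ltr01).
split=> x.
- have h : ln (E + b * `|x|) <= ln (1 + `|x|) + ln (E + b).
    rewrite -lnM ?posrE// ler_ln ?posrE ?mulr_gt0//.
    have := normr_ge0 x; nra.
  have h' : ln (E + th * `|x|) <= ln (E + b * `|x|).
    by rewrite ler_ln ?posrE// lerD2l ler_wpM2r.
  have := l1 x; have := l2 x; lra.
- move=> Qx.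
  (* As logarithms add, this compares the product (E + th |x|)(E + b |x|) with k (1 + |x|)^2; the
     gain [- ln k] is halved by the average. *)
  have h : ln (E + th * `|x|) + ln (E + b * `|x|) <= ln k + (ln (1 + `|x|) + ln (1 + `|x|)).
    rewrite -(lnM (p1 x) (p2 x)) -(lnM (px x) (px x)) -(lnM k0 (mulr_gt0 (px x) (px x))).
    rewrite (ler_ln (mulr_gt0 (p1 x) (p2 x)) (mulr_gt0 k0 (mulr_gt0 (px x) (px x)))).
    set y := `|x| in Qx *.
    have y1 : 1 <= y by rewrite (le_trans Q1)// ltW.
    have By : B <= eta * y.
      rewrite mulrC -ler_pdivrMr// (le_trans _ (ltW Qx))// /Q lerDr//.
    have By2 : B * y <= eta * y * y by rewrite ler_wpM2r// (le_trans ler01).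
    have E2 : E ^+ 2 <= E ^+ 2 * y by rewrite ler_peMr// sqr_ge0.
    have k2 : k * (y * y) <= k * ((1 + y) * (1 + y)).
      by rewrite ler_wpM2l ?(ltW k0)//; nra.
    apply: le_trans k2.
    have -> : (E + th * y) * (E + b * y) = E ^+ 2 + E * (th + b) * y + th * b * (y * y) by ring.
    have -> : k * (y * y) = eta * y * y + th * b * (y * y) by rewrite /k /eta; field.
    rewrite lerD2r; apply: le_trans By2.
    have -> : B * y = E ^+ 2 * y + E * (th + b) * y by rewrite /B mulrDl.
    by rewrite lerD2r.
  move: (l1 x) (l2 x) h; move: (ln k) => K; lra.
Qed.

(** Integrate the drift inequality against [mu]: stationarity cancels the function against its
    average over the two maps and leaves g mu[-N, N] <= (C + g) mu[-Q, Q]. As mu[-N, N] >= 1/2, this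
    gives c = g / (2 (C + g)). Only [N] depends on [mu]. *)
Lemma stationary_tight (th b d1 d2 : R) : 0 < th -> th <= b -> 0 < b -> th * b < 1 ->
  exists Q c : R, [/\ 0 < Q, 0 < c & forall a mu, 0 < a -> a <= th ->
    stationary a d1 b d2 mu -> c <= fine (mu `[- Q, Q]%classic)].
Proof.
move=> th0 thb b0 thb1.
have D0 : 0 <= `|d1| + `|d2| by rewrite addr_ge0.
have [Q [g [C [Q0 g0 C0 H]]]] := log_drift th0 thb b0 thb1 D0.
exists Q, (g / (2 * (C + g))); split=> //.
  by rewrite divr_gt0// mulr_gt0// addr_gt0.
move=> a mu a0 ath st.
have [H1 H2] := H a d1 d2 a0 ath ltac:(by rewrite lerDl) ltac:(by rewrite lerDr).
have [N0 N00 HN0] := @probability_itvT mu (1 / 2) ltac:(by []).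
pose N := Num.max N0 Q.
have QN : Q <= N by rewrite /N le_max lexx orbT.
have HN : 1 / 2 <= fine (mu `[- N, N]%classic).
  by apply: le_trans (HN0 N _); [lra|rewrite /N le_max lexx].
pose V (x : R) := ln (1 + `|x|); pose m := V N.
have V0 x : 0 <= V x by rewrite ln_ge0// lerDl.
have VE x y : `|x| <= `|y| -> V x <= V y.
  by move=> xy; rewrite ler_ln ?posrE ?ltr_pwDl// lerD2l.
(* Truncation ensures integrability. It changes nothing on [-N, N], and beyond [N] the function has
   its maximum [m], so that the inequality persists there without the gain [g]. *)
pose f x := Num.min (V x) m.
have f0 x : 0 <= f x by rewrite le_min !V0.
have fV x : f x <= V x by rewrite ge_min lexx.
have fm x : f x <= m by rewrite ge_min lexx orbT.
have bf : bounded_measurable f.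
  split; last by exists m => x; rewrite ger0_norm.
  have : measurable_fun [set: R] f.
    apply: measurable_minr; last exact: measurable_cst.
    apply: measurableT_comp; first exact: measurable_ln.
    by apply: measurable_funD; [exact: measurable_cst|exact: normr_measurable].
  exact.
pose I1 : R -> R := \1_`[- N, N]; pose I2 : R -> R := \1_`[- Q, Q].
have key (x : R) : f (affine a d1 x) * 2^-1 + f (affine b d2 x) * 2^-1 + g * I1 x
    <= f x + (C + g) * I2 x.
  have IE (P : R) : (\1_`[- P, P] : R -> R) x = (`|x| <= P)%R%:R.
    rewrite indicE; congr (nat_of_bool _)%:R; rewrite ler_norml.
    by apply/idP/idP; rewrite inE/= in_itv.
  rewrite /I1 /I2 !IE.
  have h1 := fV (affine a d1 x); have h2 := fV (affine b d2 x).
  have h3 := fm (affine a d1 x); have h4 := fm (affine b d2 x).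
  have [xQ|xQ] := leP `|x| Q.
    have xN : `|x| <= N := le_trans xQ QN.
    have -> : f x = V x.
      by apply/min_idPl; apply: VE; rewrite (ger0_norm (le_trans (ltW Q0) QN)).
    have : (V (affine a d1 x) + V (affine b d2 x)) / 2 <= V x + C := H1 x.
    rewrite xN /= !mulr1; clear -h1 h2; lra.
  have [xN|xN] := leP `|x| N.
    have -> : f x = V x.
      by apply/min_idPl; apply: VE; rewrite (ger0_norm (le_trans (ltW Q0) QN)).
    have : (V (affine a d1 x) + V (affine b d2 x)) / 2 + g <= V x := H2 x xQ.
    rewrite /= mulr1 mulr0; clear -h1 h2; lra.
  have -> : f x = m.
    by apply/min_idPr; apply: VE; rewrite (ger0_norm (le_trans (ltW Q0) QN)) ltW.
  rewrite /= !mulr0; clear -h3 h4; lra.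
have bI1 := bounded_measurable_indic (- N) N; have bI2 := bounded_measurable_indic (- Q) Q.
have bfa e d : bounded_measurable (fun x => f (affine e d x)).
  exact: bounded_measurable_affine.
have Zr c h : bounded_measurable h -> bounded_measurable (fun x => h x * c).
  by move=> /(bounded_measurableZ c) B; under eq_fun do rewrite mulrC.
have bL : bounded_measurable (fun x => f (affine a d1 x) * 2^-1 + f (affine b d2 x) * 2^-1).
  by apply: bounded_measurableD; apply: Zr.
have : \int[mu]_x (f (affine a d1 x) * 2^-1 + f (affine b d2 x) * 2^-1 + g * I1 x) <=
   \int[mu]_x (f x + (C + g) * I2 x).
  apply: le_Rintegral => //; apply: bounded_measurable_integrable;
   by apply: bounded_measurableD => //; apply: bounded_measurableZ.
rewrite !RintegralD//; try by apply: bounded_measurable_integrable;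
  rewrite ?[_ \o _]/=; do ?[apply: bounded_measurableZ|apply: Zr].
rewrite !RintegralZl ?RintegralZr//; try by apply: bounded_measurable_integrable.
rewrite !Rintegral_indic (stationary_Rintegral st bf f0).
set A1 := Rintegral _ _ _; set A2 := Rintegral _ _ _.
rewrite mulrDl lerD2l => X.
rewrite ler_pdivrMr ?mulr_gt0 ?addr_gt0//.
have : g * (1 / 2) <= (C + g) * fine (mu `[- Q, Q]%classic).
  by apply: le_trans X; rewrite ler_wpM2l// ltW.
lra.
Qed.

End tightness.

(** * Masses of small balls *)

Section ball_mass.
Context {R : realType}.
Implicit Types (mu : probability (measurableTypeR R) R) (z r : R).

Definition ball_mass mu z r : R := fine (mu `[z - r, z + r]%classic).

Lemma le_ball_mass mu z z' r r' : `|z' - z| + r <= r' ->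
  ball_mass mu z r <= ball_mass mu z' r'.
Proof.
move=> H; apply: le_fine_probability; [exact: measurable_itv|exact: measurable_itv|].
have := ler_norm (z' - z); have := ler_norm (- (z' - z)); rewrite normrN => h1 h2.
by apply: subset_itv; rewrite bnd_simp; lra.
Qed.

(** Each map sends the ball into the corresponding ball on the right, whose preimage therefore has
    at least the old mass; the other term of the stationarity equation is nonnegative. *)
Lemma stationary_ball_mass a d1 b d2 mu z r : 0 < a -> 0 < b ->
  stationary a d1 b d2 mu ->
  ball_mass mu z r / 2 <= ball_mass mu (a * z + d1) (a * r) /\
  ball_mass mu z r / 2 <= ball_mass mu (b * z + d2) (b * r).
Proof.
move=> a0 b0 st.
have key (e d : R) : 0 < e ->
    `[z - r, z + r]%classic `<=`
    affine e d @^-1` `[e * z + d - e * r, e * z + d + e * r]%classic.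
  move=> e0 x; rewrite /= !in_itv/= /affine => /andP[h1 h2].
  have := ler_wpM2l (ltW e0) h1; have := ler_wpM2l (ltW e0) h2.
  by rewrite mulrDr mulrBr; lra.
have mpre (e d : R) A : measurable A -> measurable (affine e d @^-1` A : set (measurableTypeR R)).
  by move=> mA; rewrite -[X in measurable X]setTI; exact: measurable_affine.
have st' A : measurable A -> fine (mu A) =
    fine (mu (affine a d1 @^-1` A)) / 2 + fine (mu (affine b d2 @^-1` A)) / 2.
  move=> mA; rewrite {1}(st A mA) /pushforward.
  have m1 := mpre a d1 A mA; have m2 := mpre b d2 A mA.
  rewrite -[X in (_ * X + _)%E]fineK ?fin_num_measure//.
  rewrite -[X in (_ + _ * X)%E]fineK ?fin_num_measure//.
  by rewrite -!EFinM -EFinD /= !(mulrC 2^-1).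
split; rewrite {2}/ball_mass (st' _ (measurable_itv _)).
- rewrite -[leLHS]addr0 lerD// ?divr_ge0// ?fine_ge0//.
  rewrite ler_pM2r ?invr_gt0//; apply: le_fine_probability; last exact: key.
    exact: measurable_itv.
  by apply: mpre; exact: measurable_itv.
- rewrite -[leLHS]add0r lerD// ?divr_ge0// ?fine_ge0//.
  rewrite ler_pM2r ?invr_gt0//; apply: le_fine_probability; last exact: key.
    exact: measurable_itv.
  by apply: mpre; exact: measurable_itv.
Qed.

Lemma ball_mass_fixpoint a d1 b d2 mu p r k : 0 < a -> 0 < b ->
  stationary a d1 b d2 mu -> a * p + d1 = p ->
  ball_mass mu p r / 2 ^+ k <= ball_mass mu p (a ^+ k * r).
Proof.
move=> a0 b0 st pE; elim: k => [|k ih]; first by rewrite expr0 divr1 mul1r.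
have [+ _] := @stationary_ball_mass a d1 b d2 mu p (a ^+ k * r) a0 b0 st.
rewrite pE mulrA -exprS; apply: le_trans.
by rewrite exprSr invfM mulrA ler_pM2r// invr_gt0.
Qed.

Lemma ball_mass_iter a d1 b d2 mu z r n : 0 < a -> 0 < b ->
  stationary a d1 b d2 mu ->
  ball_mass mu z r / 2 ^+ n <=
  ball_mass mu (iter n (fun x => b * x + d2) z) (b ^+ n * r).
Proof.
move=> a0 b0 st; elim: n => [|n ih]; first by rewrite expr0 divr1 mul1r.
have [_] := @stationary_ball_mass a d1 b d2 mu
  (iter n (fun x => b * x + d2) z) (b ^+ n * r) a0 b0 st.
rewrite mulrA -exprS; apply: le_trans.
by rewrite exprSr invfM mulrA ler_pM2r// invr_gt0.
Qed.

End ball_mass.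

(** * Bumps with large difference quotients *)

Section local_nondifferentiability.
Context {R : realType}.
Implicit Types (mu : probability (measurableTypeR R) R).

Lemma smooth_bounded_measurable (f : R -> R) : smooth f ->
  (forall x, 0 <= f x <= 1) -> bounded_measurable f.
Proof.
move=> sf f01; split.
  have : measurable_fun setT f.
    by apply: continuous_measurable_fun; exact: smooth_continuous.
  exact.
by exists 1 => x; have /andP[f0 f1] := f01 x; rewrite ger0_norm.
Qed.

Lemma sum_disjoint_le1 n (v : 'I_n -> R) : (forall i, v i <= 1) ->
  (forall i j, i != j -> v i != 0 -> v j = 0) -> \sum_i v i <= 1.
Proof.
move=> v1 H; have [[i vi]|h] := pselect (exists i, v i != 0).
  by rewrite (bigD1 i)//= big1 ?addr0// => j ji; apply: (H i) => //; rewrite eq_sym.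
rewrite big1// => i _; apply/eqP/negPn/negP => vi; apply: h; by exists i.
Qed.

Lemma Rintegral_sum mu n (f : 'I_n -> R -> R) :
  (forall i, bounded_measurable (f i)) ->
  bounded_measurable (fun x => \sum_i f i x) /\
  \int[mu]_x (\sum_i f i x) = \sum_i \int[mu]_x f i x.
Proof.
elim: n f => [|n ih] f bf.
  under eq_fun do rewrite big_ord0; split; first exact: bounded_measurable_cst.
  by rewrite big_ord0 (Rintegral_cst mu measurableT) mul0r.
have [bm E] := ih (fun i => f (lift ord0 i)) (fun i => bf _).
have FE : (fun x => \sum_i f i x) = (fun x => f ord0 x + \sum_i f (lift ord0 i) x).
  by apply/funext => x; rewrite big_ord_recl.
split; first by rewrite FE; exact: bounded_measurableD.
under eq_Rintegral do rewrite big_ord_recl.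
by rewrite RintegralD// ?big_ord_recl ?E//; exact: bounded_measurable_integrable.
Qed.

Lemma le_Rintegral_cst mu (f : R -> R) c : bounded_measurable f ->
  (forall x, f x <= c) -> \int[mu]_x f x <= c.
Proof.
move=> bf fc.
have -> : c = \int[mu]_x c.
  transitivity (c * fine (mu setT)); last exact/esym/Rintegral_cst.
  rewrite -[LHS]mulr1; congr (_ * _).
  exact/esym/(congr1 fine (probability_setT mu)).
apply: le_Rintegral => //; apply: bounded_measurable_integrable => //.
exact: bounded_measurable_cst.
Qed.

Lemma ball_mass_le_Rintegral mu (f : R -> R) m z r : bounded_measurable f ->
  (forall x, 0 <= f x) -> (forall x, `|x - z| <= r -> m <= f x) ->
  m * ball_mass mu z r <= \int[mu]_x f x.
Proof.
move=> bf f0 fm.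
have bI := bounded_measurable_indic (z - r) (z + r).
rewrite /ball_mass -Rintegral_indic -RintegralZl//; last first.
  exact: bounded_measurable_integrable.
apply: le_Rintegral => //; try apply: bounded_measurable_integrable => //.
  exact: bounded_measurableZ.
move=> x _; rewrite indicE; case: (boolP (_ \in _)) => [|_]; last by rewrite mulr0.
rewrite inE/= in_itv/= => /andP[h1 h2]; rewrite mulr1 fm// ler_norml; lra.
Qed.

(* Pigeonhole: along [eps_j = 5 j rho / l] the balls of radius [2 rho] round [y eps_j] are
   disjoint, hence one of them has small [mu 0]-mass, although its [mu eps_j]-mass is of order
   [2 ^- k].  Since [4 * th < 1] the ratio of this mass to [eps_j] is unbounded in [k]. *)
Lemma unbounded_quotient (mu : R -> probability (measurableTypeR R) R)
    (y : R -> R) (c Q l dt th K eta : R) :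
  0 < c -> 0 < Q -> 0 < l -> 0 < dt -> 0 < th -> 4 * th < 1 -> 0 <= K -> 0 < eta ->
  (forall e k, 0 <= e <= dt -> c / 2 ^+ k <= ball_mass (mu e) (y e) (Q * th ^+ k)) ->
  (forall e e', 0 <= e <= dt -> 0 <= e' <= dt -> l * `|e - e'| <= `|y e - y e'|) ->
  (forall e, 0 <= e <= dt -> `|y e - y 0| <= 1 / 2) ->
  exists f e, [/\ smooth f, forall x, 0 <= f x <= 1,
    forall x, 1 <= `|x - y 0| -> f x = 0, 0 < e < eta &
    K * e <= `|\int[mu e]_x f x - \int[mu 0]_x f x| ].
Proof.
move=> c0 Q0 l0 dt0 th0 th4 K0 eta0 Hm Hl Hy.
have [m m0 bump] := @smooth_bump R.
(* [h / 2^k] is half of the bump integral guaranteed for the perturbed measure, and (4 th)^k G / 2^k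
   will bound all the parameters [e j]. *)
pose h := m * c / 2; have h0 : 0 < h by rewrite divr_gt0// mulr_gt0.
pose G := 5 * Q * (1 / h + 1) / l.
have G0 : 0 < G by rewrite divr_gt0// mulr_gt0 ?mulr_gt0// addr_gt0// divr_gt0.
(* Each later summand is one demand on [k]: quotient at least [K], parameter below [eta], parameter
   at most [dt], support within distance 1 of [y 0]. The factor 2 makes the second strict; (4 th)^k
   X <= 1 secures all four. *)
pose X := 1 + K * G / h + G * 2 / eta + G / dt + 4 * Q.
have [Gp hp ep dp Qp] := And5 (ltW G0) (ltW h0) (ltW eta0) (ltW dt0) (ltW Q0).
have t1 : 0 <= K * G / h by apply: divr_ge0 => //; apply: mulr_ge0.
have t2 : 0 <= G * 2 / eta by apply: divr_ge0 => //; apply: mulr_ge0.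
have t3 : 0 <= G / dt by rewrite divr_ge0.
have t4 : 0 <= 4 * Q by rewrite mulr_ge0.
have X0 : 0 < X.
  by rewrite /X -!addrA ltr_pwDl// !addr_ge0.
have [k sX] : exists k, (4 * th) ^+ k * X <= 1.
  have : (4 * th) ^+ k @[k --> \oo] --> (0 : R).
    by apply: cvg_expr; rewrite ger0_norm// mulr_ge0// ltW.
  move=> /cvgr0Pnorm_le /(_ X^-1); rewrite invr_gt0 => /(_ X0)[k _ /(_ k (leqnn k))].
  rewrite ger0_norm ?exprn_ge0 ?mulr_ge0 ?(ltW th0)// => H.
  by exists k; rewrite -ler_pdivlMr// div1r.
pose s := (4 * th) ^+ k; rewrite -/s in sX.
have s0 : 0 < s by rewrite exprn_gt0// mulr_gt0.
pose t : R := (2 ^+ k)^-1.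
have t0 : 0 < t by rewrite invr_gt0 exprn_gt0.
have tle1 : t <= 1 by rewrite invf_le1 ?exprn_gt0// exprn_ege1// ler1n.
have thE : th ^+ k = s * t * t.
  have -> : s = 2 ^+ k * 2 ^+ k * th ^+ k by rewrite /s -!exprMn; congr (_ ^+ _); ring.
  by rewrite /t; field; rewrite expf_neq0.
have sA A : 0 <= A -> A <= X -> s * A <= 1.
  by move=> A0 AX; apply: le_trans sX; rewrite ler_wpM2l// ltW.
have s1 : s * (K * G / h) <= 1 by apply: sA => //; rewrite /X; move: (_ / h) (_ / eta) (_ / dt) t1 t2 t3 => A B C; lra.
have s2 : s * (G * 2 / eta) <= 1 by apply: sA => //; rewrite /X; move: (_ / h) (_ / eta) (_ / dt) t1 t2 t3 => A B C; lra.
have s3 : s * (G / dt) <= 1 by apply: sA => //; rewrite /X; move: (_ / h) (_ / eta) (_ / dt) t1 t2 t3 => A B C; lra.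
have s4 : s * (4 * Q) <= 1 by apply: sA => //; rewrite /X; move: (_ / h) (_ / eta) (_ / dt) t1 t2 t3 => A B C; lra.
have aux (u v w : R) : 0 < w -> u * (v / w) <= 1 -> u * v <= w.
  by move=> w0; rewrite mulrA ler_pdivrMr// mul1r.
have sG_eta : s * G < eta.
  have : s * (G * 2) <= eta := aux _ _ _ eta0 s2.
  have : 0 < s * G by rewrite mulr_gt0.
  lra.
have sG_dt : s * G <= dt by exact: aux s3.
have sKG : s * (K * G) <= h by exact: aux s1.
pose rho := Q * th ^+ k.
have rho0 : 0 < rho by rewrite mulr_gt0// exprn_gt0.
have rhoE : rho = Q * s * t * t by rewrite /rho thE; ring.
have rho4 : 4 * rho <= 1.
  apply: le_trans s4; rewrite rhoE.
  rewrite [leLHS](_ : _ = s * (4 * Q) * (t * t)); last by ring.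
  rewrite ger_pMr ?mulr_gt0//; nra.
pose tau := h * t; have tau0 : 0 < tau by rewrite mulr_gt0.
pose N := (Num.trunc tau^-1).+1.
have Ntau : 1 < N%:R * tau.
  by rewrite -ltr_pdivrMr// div1r /N truncnS_gt.
have NtauE : N%:R <= tau^-1 + 1.
  by rewrite /N -addn1 natrD lerD2r truncn_le// invr_ge0 ltW.
(* The index shift keeps [e j] positive. A step 5 rho / l moves [y] by at least 5 rho, more than
   twice the radius 2 rho of a support. *)
pose e (j : 'I_N) := (j.+1)%:R * (5 * rho / l).
have st0 : 0 < 5 * rho / l by rewrite divr_gt0// mulr_gt0.
have e0 j : 0 < e j by rewrite mulr_gt0.
have esG j : e j <= s * G * t.
  have : e j <= (tau^-1 + 1) * (5 * rho / l).
    rewrite ler_pM2r//; apply: le_trans NtauE; by rewrite ler_nat.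
  move/le_trans; apply; rewrite rhoE.
  have tE : tau^-1 * (t * t) = t / h by rewrite /tau; field; rewrite !gt_eqF.
  have -> : (tau^-1 + 1) * (5 * (Q * s * t * t) / l) =
      5 * Q * s / l * (tau^-1 * (t * t) + t * t) by ring.
  have -> : s * G * t = 5 * Q * s / l * ((1 / h + 1) * t) by rewrite /G; ring.
  rewrite tE ler_pM2l ?divr_gt0 ?mulr_gt0//.
  rewrite mulrDl mul1r mul1r [h^-1 * _]mulrC lerD2l ger_pMr//.
have edt j : 0 <= e j <= dt.
  rewrite ltW//= (le_trans (esG j))// (le_trans _ sG_dt)// ger_pMr// mulr_gt0//.
pose z j := y (e j).
have /choice[f Hf] : forall j, exists f : R -> R, [/\ smooth f, forall x, 0 <= f x <= 1,
    forall x, 2 * rho <= `|x - z j| -> f x = 0 &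
    forall x, `|x - z j| <= rho -> m <= f x].
  move=> j; have [f [f1 f2 f3 f4]] := bump (z j) (2 * rho) ltac:(by rewrite mulr_gt0).
  by exists f; split=> // x xz; apply: f4; rewrite mulrAC divff// mul1r.
have bf j : bounded_measurable (f j).
  by have [? ? _ _] := Hf j; exact: smooth_bounded_measurable.
(* Otherwise the [N] integrals add up to at least N tau > 1, while the sum of the disjointly
   supported bumps is at most 1. *)
have [j Hj] : exists j, \int[mu 0]_x f j x < tau.
  apply/not_existsP => Hn.
  have [bs E] := Rintegral_sum (mu 0) bf.
  have : \int[mu 0]_x (\sum_j f j x) <= 1.
    apply: le_Rintegral_cst => // x; apply: sum_disjoint_le1 => [i|i j ij fi].
      by have [_ /(_ x)/andP[]] := Hf i.
    have [_ _ fi0 _] := Hf i; have [_ _ fj0 _] := Hf j.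
    apply: fj0; rewrite leNgt; apply: contraNN fi => xj.
    apply/eqP/fi0; rewrite leNgt; apply/negP => xi.
    have : `|z i - z j| < 4 * rho.
      have := ler_distD x (z i) (z j); rewrite (distrC (z i) x).
      by move=> /le_lt_trans; apply; lra.
    apply/negP; rewrite -leNgt; apply: le_trans (Hl _ _ (edt i) (edt j)).
    rewrite /e -mulrBl normrM (gtr0_norm st0).
    have ij1 : 1 <= `|i.+1%:R - j.+1%:R : R|.
      have [ij'|ij'] : (i < j)%N \/ (j < i)%N.
        by apply/orP; rewrite -neq_ltn; apply/eqP => /val_inj ijE; move: ij; rewrite ijE eqxx.
        rewrite distrC -natrB ?ltnS 1?ltnW// normr_nat ler1n subn_gt0; exact: ij'.
      by rewrite -natrB ?ltnS 1?ltnW// normr_nat ler1n subn_gt0; exact: ij'.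
    have -> : l * (`|i.+1%:R - j.+1%:R| * (5 * rho / l)) = 5 * rho * `|i.+1%:R - j.+1%:R|.
      by field; rewrite gt_eqF.
    nra.
  rewrite E; apply/negP; rewrite -ltNge (lt_le_trans Ntau)//.
  have -> : N%:R * tau = \sum_(j < N) tau by rewrite sumr_const card_ord mulr_natl.
  by apply: ler_sum => i _; rewrite leNgt; apply/negP.
have [f1 f2 f3 f4] := Hf j.
exists (f j), (e j); split => //.
- move=> x xy; apply: f3; have := Hy _ (edt j); rewrite -/(z j).
  have := ler_normD (x - z j) (z j - y 0); rewrite subrKA; lra.
- rewrite e0/= (le_lt_trans (esG j))// (le_lt_trans _ sG_eta)// ger_pMr// mulr_gt0//.
- have : m * ball_mass (mu (e j)) (z j) rho <= \int[mu (e j)]_x f j x.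
    by apply: ball_mass_le_Rintegral => // x; have /andP[] := f2 x.
  have := Hm _ k (edt j); rewrite -/(z j) -/rho => H1 H2.
  (* The perturbed integral is at least 2 tau and the unperturbed one below tau; the difference
     exceeds tau, which dominates K times the parameter. *)
  have H3 : 2 * tau <= \int[mu (e j)]_x f j x.
    apply: le_trans H2; rewrite /tau /h /t.
    by rewrite [leLHS](_ : _ = m * (c / 2 ^+ k)) ?ler_pM2l//; field; rewrite expf_neq0.
  apply: (@le_trans _ _ tau); last by apply: le_trans (ler_norm _); lra.
  apply: (@le_trans _ _ (K * (s * G * t))); first by rewrite ler_wpM2l.
  rewrite (_ : _ * _ = s * (K * G) * t); last by ring.
  by rewrite /tau ler_pM2r.
Qed.

End local_nondifferentiability.

(** * The gliding hump *)

Section gliding_hump.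
Context {R : realType}.
Implicit Types (f g : R -> R).

(** [B] is the absolute value of the derivative plus 1. Non-differentiability is shown by refuting
    this one-sided linear growth. *)
Lemma derivable0_lipschitz g : derivable g 0 1 ->
  exists B eta : R, [/\ 0 <= B, 0 < eta &
    forall e, 0 < e < eta -> `|g e - g 0| <= B * e].
Proof.
move=> /cvg_ex[l /cvgrPdist_le /(_ 1 ltr01)].
case=> eta /= eta0 H; exists (`|l| + 1), eta; split; [by rewrite addr_ge0|exact: eta0|].
move=> e /andP[e0 ee].
have := H e; rewrite /= sub0r normrN (gtr0_norm e0) => /(_ ee).
rewrite gt_eqF// => /(_ isT).
rewrite addr0 [e *: 1]mulr1 /GRing.scale/= => h.
have -> : g e - g 0 = e * (e^-1 * (g e - g 0)) by rewrite mulrA divff ?mul1r// gt_eqF.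
rewrite normrM (gtr0_norm e0) mulrC ler_wpM2r ?(ltW e0)//.
have := ler_normB l (l - e^-1 * (g e - g 0)); rewrite opprB addrC subrK; lra.
Qed.

Variable mu : R -> probability (measurableTypeR R) R.
Let I e f : R := \int[mu e]_x f x.

Hypothesis local : forall M K eta : R, 0 <= M -> 0 <= K -> 0 < eta ->
  exists f e B, [/\ smooth f, forall x, 0 <= f x <= 1,
    (forall x, `|x| <= M -> f x = 0) /\ (forall x, B <= `|x| -> f x = 0),
    0 < e < eta & K * e <= `|I e f - I 0 f| ].

Let valid f (M : R) := [/\ smooth f, forall x, 0 <= f x <= 1, 0 <= M &
  forall x, M <= `|x| -> f x = 0].

Let tail e M := 1 - e <= fine (mu e `[- M, M]%classic) /\
  1 - e <= fine (mu 0 `[- M, M]%classic).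

(** Differentiability bounds the quotient of the current [f] by some [B], so a hump of quotient B +
    n + 3 outside [-M, M] leaves n + 3 for the sum. [M'] is so large that both measures have mass at
    most [e] outside [-M', M']: later humps then lower the quotient by at most 2. *)
Lemma hump_step f M (n : nat) : derivable (fun e => I e f) 0 1 -> valid f M ->
  exists f' M' e, [/\ valid f' M', M + 1 <= M', forall x, `|x| <= M -> f' x = f x,
   0 < e < n.+1%:R^-1 & n.+3%:R * e <= `|I e f' - I 0 f'| /\ tail e M'].
Proof.
move=> /derivable0_lipschitz[B [eta [B0 eta0 HB]]] [sf f01 M0 fM].
have [phi [e [C [sp p01 [pM pC] /andP[e0 ee] He]]]] :=
  @local M (B + n.+3%:R) (Num.min eta n.+1%:R^-1) M0
  ltac:(by rewrite addr_ge0) ltac:(by rewrite lt_min eta0 invr_gt0 ltr0n).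
move: ee; rewrite lt_min => /andP[eeta en].
have [N1 _ HN1] := probability_itvT (mu e) e0.
have [N2 _ HN2] := probability_itvT (mu 0) e0.
pose M' := Num.max (Num.max (M + 1) C) (Num.max N1 N2).
have [M1 [M2 [M3 M4]]] : M + 1 <= M' /\ C <= M' /\ N1 <= M' /\ N2 <= M'.
  by rewrite !le_max !lexx ?orbT.
have s' : smooth (fun x => f x + phi x) by exact: smoothD.
exists (fun x => f x + phi x), M', e; split => //.
- split => //.
  + move=> x; have [xM|xM] := leP `|x| M; first by rewrite pM// addr0.
    by rewrite fM ?(ltW xM)// add0r.
  + by apply: le_trans M1; rewrite addr_ge0.
  + move=> x xM; rewrite fM ?pC ?addr0//; first exact: le_trans xM.
    by apply: le_trans xM; apply: le_trans M1; rewrite lerDl.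
- by move=> x xM; rewrite pM// addr0.
- by rewrite e0.
- split; last by split; [exact: HN1|exact: HN2].
  have bf := smooth_bounded_measurable sf f01.
  have bp := smooth_bounded_measurable sp p01.
  have IE d : I d (fun x => f x + phi x) = I d f + I d phi.
    by apply: RintegralD => //; exact: bounded_measurable_integrable.
  rewrite !IE opprD addrACA.
  have h := HB e; rewrite e0 eeta in h; have {}h := h isT.
  have := ler_normB (I e f - I 0 f + (I e phi - I 0 phi)) (I e f - I 0 f).
  rewrite [X in `|X| <= _](_ : _ = I e phi - I 0 phi); last by ring.
  rewrite mulrDl in He.
  lra.
Qed.

(** The difference is dominated by the indicator of the complement of [-M, M]. *)
Lemma le_Rintegral_tail e (f g : R -> R) M d : bounded_measurable f -> bounded_measurable g ->
  (forall x, `|x| <= M -> g x = f x) -> (forall x, `|g x - f x| <= 1) ->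
  1 - d <= fine (mu e `[- M, M]%classic) -> `|I e g - I e f| <= d.
Proof.
move=> bf bg fg fg1 Hd.
have bI := bounded_measurable_indic (- M) M.
have bN h : bounded_measurable h -> bounded_measurable (fun x => - h x).
  by move=> /(bounded_measurableZ (-1)); under eq_fun do rewrite mulN1r.
have bgf : bounded_measurable (fun x => g x - f x).
  by apply: bounded_measurableD => //; exact: bN.
have bc : bounded_measurable (fun x => 1 - \1_`[- M, M] x).
  by apply: bounded_measurableD; [exact: bounded_measurable_cst|exact: bN].
have -> : I e g - I e f = \int[mu e]_x (g x - f x).
  by rewrite RintegralB//; exact: bounded_measurable_integrable.
have Ic : \int[mu e]_x (1 - \1_`[- M, M] x) <= d.
  rewrite RintegralB//; try exact: bounded_measurable_integrable.
    rewrite Rintegral_indic.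
    have := @le_Rintegral_cst _ (mu e) (fun=> 1) 1 (bounded_measurable_cst _) (fun=> lexx _).
    lra.
  by apply: bounded_measurable_integrable; exact: bounded_measurable_cst.
have pt x : `|g x - f x| <= 1 - \1_`[- M, M] x.
  rewrite indicE; have [xM|] := boolP (_ \in _); last by rewrite subr0.
  rewrite subrr fg ?subrr ?normr0//.
  by move: xM; rewrite inE/= in_itv/= ler_norml.
apply: le_trans Ic; rewrite ler_norml; apply/andP; split.
- rewrite lerNl -[leLHS]mulN1r -RintegralZl//; last exact: bounded_measurable_integrable.
  apply: le_Rintegral => //.
  + by apply: bounded_measurable_integrable; exact: bounded_measurableZ.
  + exact: bounded_measurable_integrable.
  + by move=> x _; rewrite mulN1r (le_trans _ (pt x))// -normrN ler_norm.
- apply: le_Rintegral => //; try exact: bounded_measurable_integrable.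
  by move=> x _; rewrite (le_trans _ (pt x))// ler_norm.
Qed.

(** If the claim fails, every smooth function with values in [0, 1] has a differentiable integral.
    This is what each hump step requires, so the construction never stops, and its limit [phi],
    again of this kind, violates the linear growth bound. *)
Lemma gliding_hump : exists phi : R -> R, [/\ smooth phi,
  [bounded phi x | x in [set: R]] & ~ derivable (fun e => I e phi) 0 1].
Proof.
apply: contrapT => Hno.
have Hder f : smooth f -> (forall x, 0 <= f x <= 1) -> derivable (fun e => I e f) 0 1.
  move=> sf f01; apply: contrapT => nd; apply: Hno; exists f; split => //.
  exists 1; split; first exact: num_real.
  by move=> m m1 x _ /=; have /andP[f0 f1] := f01 x; rewrite ger0_norm// (le_trans f1)// ltW.
pose state := {fM : (R -> R) * R | valid fM.1 fM.2}.
pose good (n : nat) (s : state) (t : state * R) :=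
  let: (f, M) := sval s in let: (f', M') := sval t.1 in let: e := t.2 in
  [/\ M + 1 <= M', forall x, `|x| <= M -> f' x = f x,
   0 < e < n.+1%:R^-1 & n.+3%:R * e <= `|I e f' - I 0 f'| /\ tail e M'].
have /choice[step Hstep] : forall ns : nat * state, exists t, good ns.1 ns.2 t.
  move=> [n [[f M] v]]; have [sf f01 _ _] := v.
  have [f' [M' [e [v' h1 h2 h3 h4]]]] := hump_step n (Hder _ sf f01) v.
  by exists (exist _ (f', M') v', e).
have v0 : valid (fun=> 0) 0.
  by split => //; [exact: smooth_cst|move=> x; rewrite lexx ler01].
pose s := fix s n : state := if n is n'.+1 then (step (n', s n')).1
  else exist _ (fun=> 0, 0) v0.
pose f n := (sval (s n)).1; pose M n := (sval (s n)).2.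
pose e n := (step (n, s n)).2.
have vf n : valid (f n) (M n) by exact: (svalP (s n)).
have H n : [/\ M n + 1 <= M n.+1, forall x, `|x| <= M n -> f n.+1 x = f n x,
   0 < e n < n.+1%:R^-1 & n.+3%:R * e n <= `|I (e n) (f n.+1) - I 0 (f n.+1)| /\
    tail (e n) (M n.+1)].
  have := Hstep (n, s n); rewrite /good /f /M /e /=.
  by case: (sval (s n)) => ? ?; case: (sval _) => ? ?.
have Mn n : n%:R <= M n.
  elim: n => [|n ih]; first by have [] := vf 0%N.
  by have [h _ _ _] := H n; rewrite (le_trans _ h)// -natr1 lerD.
have Mmono n k : M n <= M (n + k)%N.
  elim: k => [|k ih]; first by rewrite addn0.
  by have [h _ _ _] := H (n + k)%N; rewrite addnS (le_trans ih)// (le_trans _ h)// lerDl.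
have fstab n k x : `|x| <= M n -> f (n + k)%N x = f n x.
  move=> xM; elim: k => [|k ih]; first by rewrite addn0.
  have [_ h _ _] := H (n + k)%N; rewrite addnS h//.
  exact: le_trans (Mmono _ _).
(* On |x| <= M n the sequence is constant from [n] on, and M n >= n, so this index already gives the
   limit value. *)
pose phi x := f (Num.trunc `|x|).+1 x.
have phiE n x : `|x| <= M n -> phi x = f n x.
  move=> xM; pose m := (Num.trunc `|x|).+1.
  have xm : `|x| <= M m by rewrite (le_trans _ (Mn m))// ltW// truncnS_gt.
  rewrite /phi -/m.
  have [nm|mn] := leqP n m; first by rewrite -(subnKC nm) fstab.
  by rewrite -(subnKC (ltnW mn)) fstab.
have sphi : smooth phi.
  apply: smooth_local => x; exists (f (Num.trunc `|x|).+1); first by have [] := vf (Num.trunc `|x|).+1.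
  near=> y; apply/esym/phiE; apply: (le_trans _ (Mn _)).
  near: y.
  have /cvgr_le : `|y| @[y --> x] --> `|x| by apply: cvg_norm; exact: cvg_id.
  by apply; exact: truncnS_gt.
have phi01 x : 0 <= phi x <= 1.
  by rewrite /phi; have [_ h _ _] := vf (Num.trunc `|x|).+1.
have bphi := smooth_bounded_measurable sphi phi01.
have [B [eta [B0 eta0 HB]]] := derivable0_lipschitz (Hder _ sphi phi01).
(* Then e n < 1/(n + 1) < eta and B < n + 1, whereas the hump would give (n + 3) e n <= (B + 2) e n,
   the 2 coming from the tails of the two measures. *)
pose n := Num.trunc (B + eta^-1).
have nB : B + eta^-1 < n.+1%:R by exact: truncnS_gt.
have [_ _ /andP[e0 en] [He [t1 t2]]] := H n.
have [sfn fn01 _ fnM] := vf n.+1.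
have bfn := smooth_bounded_measurable sfn fn01.
have eeta : e n < eta.
  apply: (lt_trans en); rewrite invf_plt ?posrE//; apply: le_lt_trans nB; by rewrite lerDr.
have D1 x : `|phi x - f n.+1 x| <= 1.
  have /andP[a1 a2] := phi01 x; have /andP[b1 b2] := fn01 x.
  by rewrite ler_norml; lra.
have h1 := le_Rintegral_tail bfn bphi (phiE n.+1) D1 t1.
have h2 := le_Rintegral_tail bfn bphi (phiE n.+1) D1 t2.
have := HB (e n); rewrite e0 eeta => /(_ isT) h3.
have h4 : `|I (e n) (f n.+1) - I 0 (f n.+1)| <= B * e n + 2 * e n.
  move: h1 h2 h3; rewrite !ler_norml => /andP[? ?] /andP[? ?] /andP[? ?]; apply/andP; lra.
have : B * e n < n.+1%:R * e n.
  rewrite ltr_pM2r//; apply: le_lt_trans nB; by rewrite lerDl invr_ge0 ltW.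
have : n.+3%:R * e n = n.+1%:R * e n + 2 * e n :> R by rewrite -mulrDl -natrD addn2.
lra.
Unshelve. all: end_near. Qed.

End gliding_hump.

(** * Points moving with the parameter *)

Section moving_points.
Context {R : realType}.
Implicit Types (a b d th : R).

Lemma stationary_measureP a b d1 d2 : 0 < a < 1 -> 1 < b -> a * b < 1 ->
  stationary a d1 b d2 (stationary_measure d1 d2 a b).
Proof.
move=> a01 b1 ab; rewrite /stationary_measure.
by apply: (@getPex _ [set mu | stationary a d1 b d2 mu]); exact: stationary_exists.
Qed.

(** With L = ln l2, M = - ln l1 and k = ln 2 the condition reads 1/L + 1/M < 1/k. Since L < M, this
    yields 2/M < 1/k, that is M > ln 4. *)
Lemma log_condition_lt_quarter (l1 l2 : R) : 0 < l1 -> l1 < 1 -> 1 < l2 -> l1 * l2 < 1 ->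
  1 + log_base l1^-1 l2 < log_base 2 l2 -> l1 < 1 / 4.
Proof.
move=> l10 l11 l21 l12; have l20 : 0 < l2 := lt_trans ltr01 l21; rewrite /log_base lnV ?posrE//.
set L := ln l2; set M := - ln l1; set k := ln 2.
have L0 : 0 < L by rewrite /L ln_gt0.
have k0 : 0 < k by rewrite /k ln_gt0// ltr1n.
have LM : L < M.
  have : ln (l1 * l2) < 0 by rewrite ln_lt0// l12 mulr_gt0.
  by rewrite lnM ?posrE// /M /L; lra.
have M0 : 0 < M := lt_trans L0 LM.
move=> H.
have H1 : k * (M + L) < L * M.
  move: H; rewrite -subr_gt0 [X in 0 < X](_ : _ = (L * M - k * (M + L)) / (k * M)).
    by rewrite pmulr_lgt0 ?invr_gt0 ?mulr_gt0// subr_gt0.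
  by field; rewrite !gt_eqF.
have H2 : 2 * k < M.
  rewrite ltNge; apply/negP => h.
  have h1 : L * (M - k) <= L * k by rewrite ler_wpM2l ?(ltW L0)//; lra.
  have h2 : k * L < k * M by rewrite ltr_pM2l.
  by move: H1 h1 h2; rewrite mulrDr mulrBr (mulrC L k); clear; move: (k * M) (k * L) (L * M) => A B C; lra.
have : ln l1 < ln (1 / 4).
  have -> : (1 / 4 : R) = 2^-1 * 2^-1 by field.
  rewrite lnM ?posrE// lnV ?posrE// -/k.
  by move: H2; rewrite /M; lra.
by rewrite ltr_ln// posrE.
Qed.

Lemma expr_unbounded b (A w : R) : 1 < b -> 0 < w -> exists n, A <= b ^+ n * w.
Proof.
move=> b1 w0; have b0 : 0 < b := lt_trans ltr01 b1.
have A1 : 0 < `|A| + 1 by rewrite ltr_wpDl.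
have : b^-1 ^+ n @[n --> \oo] --> (0 : R).
  by apply: cvg_expr; rewrite ger0_norm ?invr_ge0 ?ltW// invf_lt1.
move=> /cvgr0Pnorm_le /(_ (w / (`|A| + 1))); rewrite divr_gt0// => /(_ isT)[n _ /(_ n (leqnn n))].
rewrite ger0_norm ?exprn_ge0 ?invr_ge0 ?(ltW b0)// exprVn => H.
exists n; apply: (@le_trans _ _ (`|A| + 1)); first by have := ler_norm A; lra.
rewrite mulrC -ler_pdivrMr ?exprn_gt0// mulrC -ler_pdivlMr//.
Qed.

Lemma iter_affine b d p z n : b * p + d = p ->
  iter n (fun x => b * x + d) z = p + b ^+ n * (z - p).
Proof.
move=> pE; elim: n => [|n ih]; first by rewrite expr0 mul1r addrC subrK.
by rewrite iterS ih exprS mulrDr -{3}pE; ring.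
Qed.

Section fixed_parameters.
Variables (l1 l2 d1 d2 th : R).
Hypotheses (hfix : d1 / (1 - l1) <> d2 / (1 - l2)).
Hypotheses (l10 : 0 < l1) (l21 : 1 < l2) (l1th : l1 < th) (th1 : th < 1) (thl2 : th * l2 < 1).

Let m (e : R) := stationary_measure d1 d2 (l1 + e) l2.

Let param (e : R) : 0 <= e <= th - l1 -> 0 < l1 + e <= th.
Proof. by move=> /andP[e0 e1]; rewrite ltr_wpDr//= addrC -lerBrDr. Qed.

Let m_stationary (e : R) : 0 <= e <= th - l1 -> stationary (l1 + e) d1 l2 d2 (m e).
Proof.
move=> /param /andP[a0 ath]; apply: stationary_measureP => //.
  by rewrite a0 (le_lt_trans ath).
by apply: le_lt_trans thl2; rewrite ler_pM2r// (lt_trans ltr01).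
Qed.

Let l20 : 0 < l2 := lt_trans ltr01 l21.

(** Tightness gives mass [c] to a ball round 0. The fixed points are bounded by |d1| / (1 - th), so
    a larger ball round each of them contains it; contracting [k] times has ratio (l1 + e)^k <=
    th^k, uniformly in [e]. *)
Lemma fixpoint_mass : exists c Q, [/\ 0 < c, 0 < Q & forall (e : R) k, 0 <= e <= th - l1 ->
  c / 2 ^+ k <= ball_mass (m e) (d1 / (1 - (l1 + e))) (Q * th ^+ k)].
Proof.
have th0 : 0 < th := lt_trans l10 l1th.
have [Q0 [c [Q00 c0 H]]] := @stationary_tight R th l2 d1 d2 th0
  (ltW (lt_trans th1 l21)) l20 thl2.
have P0 : 0 <= `|d1| / (1 - th) by rewrite divr_ge0// subr_ge0 ltW.
exists c, (Q0 + `|d1| / (1 - th)); split=> //; first by rewrite ltr_pwDl.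
move=> e k he; have /andP[a0 ath] := param he; have st := m_stationary he.
set p := d1 / _.
have a1 : 0 < 1 - (l1 + e) by rewrite subr_gt0 (le_lt_trans ath).
have pE : (l1 + e) * p + d1 = p by rewrite /p; field; rewrite gt_eqF.
have pP : `|p| <= `|d1| / (1 - th).
  rewrite /p normrM normfV (gtr0_norm a1) ler_wpM2l// lef_pV2 ?posrE// ?subr_gt0//.
  by rewrite lerB.
apply: (@le_trans _ _ (ball_mass (m e) p (Q0 + `|d1| / (1 - th)) / 2 ^+ k)).
  rewrite ler_pM2r ?invr_gt0 ?exprn_gt0//.
  apply: (@le_trans _ _ (ball_mass (m e) 0 Q0)).
    by rewrite /ball_mass sub0r add0r; exact: H a0 ath st.
  by apply: le_ball_mass; rewrite subr0 addrC lerD2l.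
apply: (le_trans (ball_mass_fixpoint _ k a0 l20 st pE)).
apply: le_ball_mass; rewrite subrr normr0 add0r mulrC.
rewrite ler_wpM2l ?addr_ge0 ?(ltW Q00)//.
by rewrite lerXn2r ?nnegrE ?(ltW a0)// ltW.
Qed.

Let p2 := d2 / (1 - l2).

Let p2E : l2 * p2 + d2 = p2.
Proof. by rewrite /p2; field; rewrite lt_eqF// subr_lt0. Qed.

(* For [d1 != 0] the fixed point of the contraction moves with the parameter, and the points are
   its images under the iterates of the expansion; for [d1 = 0] it stays at [0], and one more
   application of the contraction is needed. *)
Lemma moving_points M : 0 <= M -> exists y c Q l dt, [/\ [/\ 0 < c, 0 < Q, 0 < l & 0 < dt],
  M + 1 <= `|y 0| :> R,
  forall (e : R) k, 0 <= e <= dt -> c / 2 ^+ k <= ball_mass (m e) (y e) (Q * th ^+ k),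
  forall e e' : R, 0 <= e <= dt -> 0 <= e' <= dt -> l * `|e - e'| <= `|y e - y e'| &
  forall e : R, 0 <= e <= dt -> `|y e - y 0| <= 1 / 2].
Proof.
move=> M0; have [c [Q [c0 Q0 HQ]]] := fixpoint_mass.
have th0 : 0 < th := lt_trans l10 l1th.
have dt0 : 0 < th - l1 by rewrite subr_gt0.
have small (A : R) : 0 < A -> exists2 dt, 0 < dt <= th - l1 & dt * A <= 1 / 2.
  move=> A0; exists (Num.min (th - l1) (1 / 2 / A)).
    by rewrite lt_min dt0 !divr_gt0//= ge_min lexx.
  by rewrite -ler_pdivlMr// ge_min lexx orbT.
have inc (dt e : R) : dt <= th - l1 -> 0 <= e <= dt -> 0 <= e <= th - l1.
  by move=> h /andP[-> /le_trans]; exact.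
pose p (e : R) := d1 / (1 - (l1 + e)).
(* Applying the expansion [n] times divides the mass bound by 2^n and multiplies the radius by l2^n;
   for fixed [n] both go into the constants. *)
have mass n (e : R) k : 0 <= e <= th - l1 -> c / 2 ^+ n / 2 ^+ k <=
    ball_mass (m e) (p2 + l2 ^+ n * (p e - p2)) (l2 ^+ n * Q * th ^+ k).
  move=> he; have /andP[a0 _] := param he.
  have := ball_mass_iter (p e) (Q * th ^+ k) n a0 l20 (m_stationary he).
  rewrite (iter_affine _ _ p2E) mulrA; apply: le_trans.
  by rewrite mulrAC ler_pM2r ?invr_gt0 ?exprn_gt0// HQ.
have [d10|d10] := eqVneq d1 0.
- have p0 e : p e = 0 by rewrite /p d10 mul0r.
  have p2N0 : 0 < `|p2|.
    rewrite normr_gt0; apply/eqP => h; apply: hfix.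
    by rewrite d10 mul0r -/p2 h.
  (* [n] expansions take 0 to [w] with |w| >= (l2^n - 1) |p2|. The point at parameter 0 will be l1
     w, whence the division by [l1]. *)
  have [n Hn] := @expr_unbounded l2 (`|p2| + (M + 1) / l1 + 1) `|p2| l21 p2N0.
  pose w := p2 + l2 ^+ n * (0 - p2).
  have wE : `|p2| + `|w| >= l2 ^+ n * `|p2|.
    have := ler_normB p2 w; rewrite /w sub0r mulrN opprD opprK addNKr.
    by rewrite normrM ger0_norm ?exprn_ge0 ?(ltW l20).
  have wM : (M + 1) / l1 + 1 <= `|w| by lra.
  have w0 : 0 < `|w|.
    apply: lt_le_trans wM; rewrite ltr_wpDl// divr_ge0 ?(ltW l10)//.
    by rewrite addr_ge0.
  have [dt /andP[dt1 dt2] dtw] := small `|w| w0.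
  exists (fun e => (l1 + e) * w), (c / 2 ^+ n / 2), (l2 ^+ n * Q), `|w|, dt; split.
  + by split => //; rewrite ?divr_gt0 ?mulr_gt0 ?exprn_gt0.
  + rewrite addr0 normrM (gtr0_norm l10) mulrC -ler_pdivrMr//; lra.
  + move=> e k /(inc _ _ dt2) he; have /andP[a0 ath] := param he.
    have := mass n e k he; rewrite p0 -/w => h1.
    have [h2 _] := stationary_ball_mass w (l2 ^+ n * Q * th ^+ k) a0 l20 (m_stationary he).
    rewrite mulrAC; apply: (@le_trans _ _ (ball_mass (m e) w (l2 ^+ n * Q * th ^+ k) / 2)).
      by rewrite ler_pM2r ?invr_gt0.
    apply: (le_trans h2); apply: le_ball_mass; rewrite d10 addr0 subrr normr0 add0r.
    rewrite ger_pMl ?mulr_gt0 ?exprn_gt0//; exact: le_trans ath (ltW th1).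
  + move=> e e' _ _; rewrite -mulrBl normrM mulrC ler_wpM2r//.
    by rewrite opprD addrACA subrr add0r.
  + move=> e /andP[e0 edt]; rewrite -mulrBl addr0 addrC addKr normrM ger0_norm//.
    by apply: le_trans dtw; rewrite ler_wpM2r.
(* By [hfix] the two fixed points differ at parameter 0, so the expansion drives [p 0] away from
   [p2] without bound. *)
- have w0 : 0 < `|p 0 - p2|.
    by rewrite normr_gt0 subr_eq0 /p addr0; apply/eqP.
  have [n Hn] := @expr_unbounded l2 (`|p2| + M + 1) `|p 0 - p2| l21 w0.
  have bn : 1 <= l2 ^+ n by rewrite exprn_ege1// ltW.
  have bn0 : 0 < l2 ^+ n by rewrite exprn_gt0.
  pose A := l2 ^+ n * `|d1| / (1 - th) ^+ 2.
  have th1' : 0 < 1 - th by rewrite subr_gt0.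
  have A0 : 0 < A by rewrite divr_gt0 ?mulr_gt0 ?exprn_gt0// normr_gt0.
  have [dt /andP[dt1 dt2] dtA] := small A A0.
  (* The difference is d1 (e - e') / (u v) with u and v in [1 - th, 1], which gives both bounds. *)
  have diff (e e' : R) : 0 <= e <= dt -> 0 <= e' <= dt ->
    `|d1| * `|e - e'| <= `|p e - p e'| <= `|d1| / (1 - th) ^+ 2 * `|e - e'|.
    move=> /(inc _ _ dt2)/param/andP[a0 ath] /(inc _ _ dt2)/param/andP[b0 bth].
    set u := 1 - (l1 + e); set v := 1 - (l1 + e').
    have [u0 u1] : 1 - th <= u /\ u <= 1 by rewrite /u; split; lra.
    have [v0 v1] : 1 - th <= v /\ v <= 1 by rewrite /v; split; lra.
    have up : 0 < u := lt_le_trans th1' u0.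
    have vp : 0 < v := lt_le_trans th1' v0.
    have -> : p e - p e' = d1 * (e - e') / (u * v).
      rewrite /p -/u -/v [e - e'](_ : _ = v - u); last by rewrite /u /v; ring.
      by field; rewrite !gt_eqF.
    rewrite !normrM normfV (gtr0_norm (mulr_gt0 up vp)); apply/andP; split.
      by rewrite ler_peMr ?mulr_ge0// invf_ge1 ?mulr_gt0// mulr_ile1// ltW.
    rewrite mulrAC ler_wpM2r// ler_wpM2l// lef_pV2 ?posrE ?mulr_gt0 ?exprn_gt0//.
    by rewrite expr2 ler_pM// ltW.
  exists (fun e => p2 + l2 ^+ n * (p e - p2)), (c / 2 ^+ n), (l2 ^+ n * Q), `|d1|, dt; split.
  + by split => //; rewrite ?divr_gt0 ?mulr_gt0 ?exprn_gt0 ?normr_gt0.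
  + have := ler_normB (p2 + l2 ^+ n * (p 0 - p2)) p2.
    rewrite addrC addKr normrM (gtr0_norm bn0); lra.
  + by move=> e k /(inc _ _ dt2); exact: mass.
  + move=> e e' he he'; have /andP[h _] := diff _ _ he he'.
    have -> : p2 + l2 ^+ n * (p e - p2) - (p2 + l2 ^+ n * (p e' - p2)) = l2 ^+ n * (p e - p e').
      by ring.
    rewrite normrM (gtr0_norm bn0); apply: (le_trans h); exact: ler_peMl.
  + move=> e he; have h0 : 0 <= (0 : R) <= dt by apply/andP; split => //; exact: ltW.
    have /andP[_ h] := diff _ _ he h0.
    have -> : p2 + l2 ^+ n * (p e - p2) - (p2 + l2 ^+ n * (p 0 - p2)) = l2 ^+ n * (p e - p 0).
      by ring.
    rewrite normrM (gtr0_norm bn0); apply: le_trans dtA.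
    move: he h => /andP[e0 edt]; rewrite subr0 (ger0_norm e0) => h.
    have : l2 ^+ n * `|p e - p 0| <= l2 ^+ n * (`|d1| / (1 - th) ^+ 2 * e) by rewrite ler_pM2l.
    move/le_trans; apply; rewrite mulrA mulrA -/A mulrC.
    by rewrite ler_wpM2r ?(ltW A0).
Qed.

End fixed_parameters.
End moving_points.

Unset Implicit Arguments.
Set Strict Implicit.

Theorem theorem1p5 (R : realType) (lambda1 lambda2 d1 d2 : R)
    (hfix : d1 / (1 - lambda1) <> d2 / (1 - lambda2))
    (hlambda1_gt0 : 0 < lambda1) (hlambda1_lt1 : lambda1 < 1)
    (hlambda2_gt1 : 1 < lambda2) (hprod : lambda1 * lambda2 < 1)
    (hlog : 1 + log_base lambda1^-1 lambda2 < log_base 2 lambda2) :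
  exists phi : R -> R,
    [/\ smooth phi,
        [bounded phi x | x in [set: R]] &
        ~ derivable
            (fun epsilon : R =>
               \int[stationary_measure d1 d2 (lambda1 + epsilon) lambda2]_x
                 phi x : R)
            0 1].
Proof.
have quarter := log_condition_lt_quarter hlambda1_gt0 hlambda1_lt1 hlambda2_gt1 hprod hlog.
have l20 : 0 < lambda2 := lt_trans ltr01 hlambda2_gt1.
(* [th] is the midpoint of [lambda1] and min(1/4, 1/lambda2). *)
have [th [th_gt th_quarter th_prod]] : exists th, [/\ lambda1 < th, th < 1 / 4 & th * lambda2 < 1].
  have h : lambda1 < Num.min (1 / 4) lambda2^-1.
    by rewrite lt_min quarter -[lambda2^-1]mul1r ltr_pdivlMr.
  exists ((lambda1 + Num.min (1 / 4) lambda2^-1) / 2).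
  have h1 : Num.min (1 / 4) lambda2^-1 <= 1 / 4 by rewrite ge_min lexx.
  have h2 : Num.min (1 / 4) lambda2^-1 <= lambda2^-1 by rewrite ge_min lexx orbT.
  split; [lra|lra|].
  rewrite -[ltRHS](mulVf (x := lambda2)) ?gt_eqF// ltr_pM2r//.
  by apply: (@lt_le_trans _ _ (Num.min (1 / 4) lambda2^-1)) h2; lra.
have th1 : th < 1 by lra.
have th0 : 0 < th := lt_trans hlambda1_gt0 th_gt.
apply: gliding_hump => M K eta M0 K0 eta0.
have [y [c [Q [l [dt [[c0 Q0 l0 dt0] yM Hm Hl Hy]]]]]] :=
  moving_points hfix hlambda1_gt0 hlambda2_gt1 th_gt th1 th_prod M0.
have th4 : 4 * th < 1 by lra.
have [f [e [sf f01 fy e0 He]]] := unbounded_quotient c0 Q0 l0 dt0 th0 th4 K0 eta0 Hm Hl Hy.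
(* The bump vanishes at distance at least 1 from [y 0], and |y 0| >= M + 1 keeps it off [-M, M]. *)
exists f, e, (`|y 0| + 1); split => //; split => x xM; apply: fy.
- have := ler_normD (y 0 - x) x; rewrite subrK distrC; lra.
- have := ler_normD (x - y 0) (y 0); rewrite subrK; lra.
Qed.
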